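(* Let $p$ be a prime, $d\ge 1$, $K$ a number field with ring of integers $\mathcal{O}_K$, and let $f\in \mathcal{O}_K[t_1^{\pm1},\dots,t_d^{\pm1}]$. Assume that $N_{K/\mathbb{Q}}(f)$ does not vanish at any point of the $p$-adic torus $T_p^d=\{(z_1,\dots,z_d)\in\mathbb{C}_p^d : |z_1|_p=\dots=|z_d|_p=1\}$. Let $X_f$ be the Pontryagin dual of the discrete group $\mathcal{O}_K[t_1^{\pm1},\dots,t_d^{\pm1}]/f\,\mathcal{O}_K[t_1^{\pm1},\dots,t_d^{\pm1}]$, with the $\mathbb{Z}^d$-action described in the context. Then the $p$-adic entropy $h_p(X_f)$ exists and $$h_p(X_f)=m_p(N_{K/\mathbb{Q}}(f)).$$
   Context: $\mathbb{C}_p$ is the completion of an algebraic closure of $\mathbb{Q}_p$ with $|p|_p=p^{-1}$, and $\log_p$ is the $p$-adic logarithm on $\mathbb{C}_p^\times$ normalized by $\log_p p=0$. For $\nu=(\nu_1,\dots,\nu_d)\in\mathbb{Z}^d$ write $t^\nu=t_1^{\nu_1}\cdots t_d^{\nu_d}$. The group $\mathbb{Z}^d$ acts on $\mathcal{O}_K[t_1^{\pm1},\dots,t_d^{\pm1}]$ by $\delta\cdot\sum_\nu a_\nu t^\nu=\sum_\nu a_\nu t^{\nu+\delta}$ (multiplication by $t^\delta$); this induces an action on the quotient by $f\,\mathcal{O}_K[t^{\pm1}]$ and hence, by duality, on its Pontryagin dual $X_f$. For a $\mathbb{Z}^d$-set $X$, $\mathrm{Fix}_{(n\mathbb{Z})^d}(X)$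 denotes the set of points fixed by the subgroup $(n\mathbb{Z})^d$, and the $p$-adic entropy is $h_p(X)=\lim_{n\to\infty,\,(n,p)=1}\frac{1}{n^d}\log_p|\mathrm{Fix}_{(n\mathbb{Z})^d}(X)|$ if this limit exists (in $\mathbb{C}_p$). For $g\in\mathbb{C}_p[t_1^{\pm1},\dots,t_d^{\pm1}]$, the $p$-adic Mahler measure is $m_p(g)=\lim_{N\to\infty,\,(N,p)=1}\frac{1}{N^d}\sum_{\zeta\in\mu_N^d}\log_p g(\zeta)$ if the limit exists, where $\mu_N=\{z\in\mathbb{C}_p: z^N=1\}$. For $f=\sum_\nu a_\nu t^\nu$ with $a_\nu\in\mathcal{O}_K$ and an embedding $\tau:K\hookrightarrow\mathbb{C}$, $\tau(f)=\sum_\nu\tau(a_\nu)t^\nu$, and $N_{K/\mathbb{Q}}(f)=\prod_{\tau:K\hookrightarrow\mathbb{C}}\tau(f)\in\mathbb{Z}[t_1^{\pm1},\dots,t_d^{\pm1}]$, regarded as a Laurent polynomial with coefficients in $\mathbb{Z}\subset\mathbb{C}_p$. *)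

(* Defs.v *)
From HB Require Import structures.
From mathcomp Require Import all_boot all_order all_algebra all_field.
From mathcomp Require Import finmap generic_quotient ring_quotient complex.
From mathcomp Require Import all_classical all_reals all_analysis.

Set Implicit Arguments.
Unset Strict Implicit.
Unset Printing Implicit Defensive.

Import Order.TTheory GRing.Theory Num.Theory.
Import numFieldNormedType.Exports.

Local Open Scope classical_set_scope.
Local Open Scope ring_scope.

(* [R[t_1^{±1}, ..., t_d^{±1}]]: the coefficient of [t^nu] in [f] is [f nu]. *)
Definition laurent (d : nat) (R : comNzRingType) :=
  {fsfun 'rV[int]_d -> R with 0}.
HB.instance Definition _ d R := Choice.on (laurent d R).

Section Laurent.
Context (d : nat) (R : comNzRingType).
Implicit Types (f g h : laurent d R) (a b c : 'rV[int]_d).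

Definition lmonom a : laurent d R := [fsfun c in [fset a]%fset => 1].

Definition ladd f g : laurent d R :=
  [fsfun c in (finsupp f `|` finsupp g)%fset => f c + g c].

Definition lopp f : laurent d R := [fsfun c in finsupp f => - f c].

Definition lmul f g : laurent d R :=
  [fsfun c in [fset (a + b)%R | a in finsupp f, b in finsupp g]%fset =>
    \sum_(a <- finsupp f) f a * g (c - a)].

Lemma lmonomE a c : lmonom a c = (c == a)%:R.
Proof. by rewrite fsfunE inE; case: eqP. Qed.

Lemma laddE f g c : ladd f g c = f c + g c.
Proof.
rewrite fsfunE in_fsetU; case: finsuppP => //= _; case: finsuppP => //= _.
by rewrite addr0.
Qed.

Lemma loppE f c : lopp f c = - f c.
Proof. by rewrite fsfunE; case: finsuppP => //= _; rewrite oppr0. Qed.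

Lemma lmulE f g c : lmul f g c = \sum_(a <- finsupp f) f a * g (c - a).
Proof.
rewrite fsfunE; case: ifPn => // cNfg; rewrite big_seq big1 // => a af.
have [bg|/fsfun_dflt ->] := boolP (c - a \in finsupp g); last by rewrite mulr0.
case/negP: cNfg; apply/imfset2P; exists a => //.
by exists (c - a) => //; rewrite subrKC.
Qed.

Lemma lsum_widen f (F : 'rV[int]_d -> R) (A : {fset 'rV[int]_d}) :
  (finsupp f `<=` A)%fset ->
  \sum_(a <- finsupp f) f a * F a = \sum_(a <- A) f a * F a.
Proof.
move=> fA; apply: big_fset_incl => // a _ /fsfun_dflt ->; exact: mul0r.
Qed.

Lemma laddA : associative ladd.
Proof. by move=> f g h; apply/fsfunP => c; rewrite !laddE addrA. Qed.

Lemma laddC : commutative ladd.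
Proof. by move=> f g; apply/fsfunP => c; rewrite !laddE addrC. Qed.

Lemma ladd0 : left_id ([fsfun] : laurent d R) ladd.
Proof. by move=> f; apply/fsfunP => c; rewrite laddE fsfun0E add0r. Qed.

Lemma laddN : left_inverse ([fsfun] : laurent d R) lopp ladd.
Proof. by move=> f; apply/fsfunP => c; rewrite laddE loppE fsfun0E addNr. Qed.

HB.instance Definition _ :=
  GRing.isZmodule.Build (laurent d R) laddA laddC ladd0 laddN.

Lemma lmulC : commutative lmul.
Proof.
move=> f g; apply/fsfunP => c; rewrite !lmulE.
pose A := (finsupp f `|` [fset (c - b)%R | b in finsupp g])%fset.
rewrite (@lsum_widen f _ A) ?fsubsetUl //.
have inj_cB : injective (fun b => c - b) by move=> x y /addrI/oppr_inj.
rewrite (@lsum_widen g _ [fset (c - a)%R | a in A]%fset); last first.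
  apply/fsubsetP => b bg; apply/imfsetP; exists (c - b); last by rewrite subKr.
  by rewrite /= in_fsetU; apply/orP; right; apply/imfsetP; exists b.
rewrite (@big_imfset _ _ _ _ _ _ (fun a => c - a)) /=; last first.
  by move=> x y _ _; exact: inj_cB.
by apply: eq_bigr => a _; rewrite subKr mulrC.
Qed.

Lemma lmulDl : left_distributive lmul ladd.
Proof.
move=> f g h; apply/fsfunP => c; rewrite laddE !lmulE.
rewrite (@lsum_widen (ladd f g) _ (finsupp f `|` finsupp g)%fset); last first.
  apply/fsubsetP => a; rewrite in_fsetU !mem_finsupp laddE.
  by apply: contraNT; rewrite negb_or !negbK => /andP[/eqP-> /eqP->]; rewrite addr0.
rewrite (@lsum_widen f _ (finsupp f `|` finsupp g)%fset) ?fsubsetUl //.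
rewrite (@lsum_widen g _ (finsupp f `|` finsupp g)%fset) ?fsubsetUr //.
by rewrite -big_split; apply: eq_bigr => a _; rewrite laddE mulrDl.
Qed.

Lemma lmulA : associative lmul.
Proof.
move=> f g h; apply/fsfunP => c; rewrite !lmulE.
pose A := [fset (a + b)%R | a in finsupp f, b in finsupp g]%fset.
rewrite (@lsum_widen (lmul f g) _ A); last first.
  apply/fsubsetP => e; rewrite mem_finsupp; apply: contraR => eA.
  by rewrite /lmul fsfunE (negPf eA).
under [RHS]eq_bigr => e _ do rewrite lmulE mulr_suml.
rewrite exchange_big /= big_seq [RHS]big_seq; apply: eq_bigr => a af.
rewrite lmulE mulr_sumr.
rewrite -(@big_fset_incl _ _ _ _ [fset (a + b)%R | b in finsupp g]%fset A) /=.
- rewrite (@big_imfset _ _ _ _ _ _ (fun b => a + b)) /=; last first.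
    by move=> x y _ _; exact: addrI.
  by apply: eq_bigr => b _; rewrite mulrA opprD addrA [a + b]addrC addrK.
- apply/fsubsetP => _ /imfsetP[b /= bg ->].
  by apply/imfset2P; exists a => //; exists b.
- move=> e _ eN; rewrite (_ : g (e - a) = 0) ?mulr0 ?mul0r //.
  apply: fsfun_dflt; apply: contra eN => eg; apply/imfsetP.
  by exists (e - a) => //; rewrite subrKC.
Qed.

Lemma lmul1 : left_id (lmonom 0) lmul.
Proof.
move=> f; apply/fsfunP => c; rewrite lmulE (@lsum_widen _ _ [fset 0%R]%fset).
  by rewrite big_seq_fset1 lmonomE eqxx mul1r subr0.
apply/fsubsetP => a; rewrite mem_finsupp lmonomE inE.
by case: (a =P 0) => // _; rewrite eqxx.
Qed.

Lemma lone_neq0 : lmonom 0 != 0 :> laurent d R.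
Proof.
apply/eqP => /fsfunP/(_ 0); rewrite lmonomE eqxx fsfun0E => /eqP.
by rewrite oner_eq0.
Qed.

HB.instance Definition _ := GRing.Zmodule_isComNzRing.Build (laurent d R)
  lmulA lmulC lmul1 lmulDl lone_neq0.

End Laurent.
Arguments lmonom {d R} a.

(* The image of [f] under coefficientwise application of [phi], [phi 0 = 0]. *)
Definition lmap d (R S : comNzRingType) (phi : R -> S) (f : laurent d R) :
    laurent d S :=
  [fsfun a in finsupp f => phi (f a)].

Definition leval d (F : fieldType) (f : laurent d F) (z : 'rV[F]_d) : F :=
  \sum_(a <- finsupp f) f a * \prod_(i < d) z 0 i ^ a 0 i.

Section Integers.
Context (K : fieldExtType rat).

Definition alg_integer : {pred K} :=
  fun x => `[< integralOver (intr : int -> K) x >].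

Fact alg_integer_subring : subring_closed alg_integer.
Proof.
split=> [|x y /asboolP xi /asboolP yi|x y /asboolP xi /asboolP yi].
- by apply/asboolP; exact: integral1.
- by apply/asboolP; exact: integral_sub.
- by apply/asboolP; exact: integral_mul.
Qed.
HB.instance Definition _ :=
  GRing.isSubringClosed.Build K alg_integer alg_integer_subring.

Record int_ring : predArgType :=
  IntRing { int_ring_val :> K; _ : int_ring_val \in alg_integer }.
HB.instance Definition _ := [isSub for int_ring_val].
HB.instance Definition _ := [Choice of int_ring by <:].
HB.instance Definition _ := [SubChoice_isSubComNzRing of int_ring by <:].

End Integers.

Section Norm.
Context (R : realType) (K : fieldExtType rat) (d : nat).

Definition embeddings : set (K -> R[i]) :=
  range (fun tau : {rmorphism K -> R[i]} => tau : K -> R[i]).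

Definition complex_norm (f : laurent d (int_ring K)) : laurent d R[i] :=
  \big[*%R/1]_(tau \in embeddings) lmap (fun x : int_ring K => tau x) f.

Definition int_of_complex (z : R[i]) : int := xget 0 [set n : int | n%:~R = z].

(* The coefficients of [complex_norm f] are in the image of [int]; [lnorm f] is
   the same Laurent polynomial with coefficients read in [int]. *)
Definition lnorm (f : laurent d (int_ring K)) : laurent d int :=
  lmap int_of_complex (complex_norm f).

End Norm.

Section Quotient.
Context (d : nat) (A : comNzRingType) (f : laurent d A).
Local Open Scope quotient_scope.

Definition principal_ideal : {pred laurent d A} :=
  fun g => `[< exists h, g = f * h >].

Fact principal_ideal_zmod : zmod_closed principal_ideal.
Proof.
split=> [|_ _ /asboolP[g ->] /asboolP[h ->]]; apply/asboolP.
  by exists 0; rewrite mulr0.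
by exists (g - h); rewrite mulrBr.
Qed.
HB.instance Definition _ :=
  GRing.isZmodClosed.Build (laurent d A) principal_ideal principal_ideal_zmod.

(* The quotient is taken as an additive group because the library's quotient
   rings require a proper ideal, whereas [f] may be a unit. *)
Definition laurent_quot : zmodType := Quotient.quot principal_ideal.

Definition shift (delta : 'rV[int]_d) (x : laurent_quot) : laurent_quot :=
  \pi_(Quotient.quot principal_ideal) (lmonom delta * repr x).

Lemma shift_pi delta g :
  shift delta (\pi g) = \pi_(Quotient.quot principal_ideal) (lmonom delta * g).
Proof.
apply/eqP; rewrite -Quotient.idealrBE -mulrBr; apply/asboolP.
have /asboolP[h hE] : repr (\pi_(Quotient.quot principal_ideal) g) - g
    \in principal_ideal by rewrite Quotient.idealrBE reprK.
by exists (lmonom delta * h); rewrite hE mulrCA.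
Qed.

End Quotient.

Section Dual.
Context (R : realType).

(* The Pontryagin dual of a discrete abelian group [M]: all homomorphisms from
   [M] to the circle group. Its topology plays no role in counting fixed
   points. *)
Record pontryagin_dual (M : zmodType) := Character {
  char_val :> M -> R[i];
  char_add : {morph char_val : x y / x + y >-> x * y};
  char_circle : forall x, `|char_val x| = 1 }.

Context (d : nat) (A : comNzRingType) (f : laurent d A).

Definition dual_system : Type := pontryagin_dual (laurent_quot f).

Fact shift_add delta : {morph shift (f := f) delta : x y / x + y}.
Proof.
elim/quotW=> g; elim/quotW=> h.
by rewrite -[in LHS]raddfD !shift_pi mulrDr raddfD.
Qed.

Fact dual_shift_add delta (chi : dual_system) :
  {morph (fun x => chi (shift delta x)) : x y / x + y >-> x * y}.
Proof. by move=> x y /=; rewrite shift_add char_add. Qed.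

(* [(t^delta . chi)(x) = chi(t^delta x)]; precomposing with [t^-delta] instead
   gives the same fixed points. *)
Definition dual_shift (delta : 'rV[int]_d) (chi : dual_system) : dual_system :=
  Character (dual_shift_add delta chi) (fun x => char_circle chi (shift delta x)).

End Dual.

Section Padic.
Context (R : realType) (p : nat) (Cp : fieldType) (nrm : Cp -> R).

(* The closure of [Q] in [Cp]; for [Cp] complete and [|p| = 1/p] this is
   [Q_p]. *)
Definition padic_rational (x : Cp) : Prop :=
  forall e : R, 0 < e -> exists q : rat, nrm (x - ratr q) < e.

Definition padic_algebraic (x : Cp) : Prop :=
  exists P : {poly Cp},
    [/\ P != 0, forall i, padic_rational P`_i & root P x].

(* [Cp] is a completion of an algebraic closure of [Q_p], with
   [|p| = 1/p]. *)
Record is_padic_complex : Prop := IsPadicComplex {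
  nrm_ge0 : forall x, 0 <= nrm x;
  nrm_eq0 : forall x, nrm x = 0 <-> x = 0;
  nrmM : forall x y, nrm (x * y) = nrm x * nrm y;
  nrm_ultra : forall x y, nrm (x + y) <= Num.max (nrm x) (nrm y);
  nrm_p : nrm p%:R = p%:R^-1;
  nrm_complete : forall u : nat -> Cp,
    (forall e : R, 0 < e -> exists N, forall m n,
       (N <= m)%N -> (N <= n)%N -> nrm (u m - u n) < e) ->
    exists l, nrm (u n - l) @[n --> \oo] --> (0 : R);
  padic_algebraic_closed : forall P : {poly Cp},
    (1 < size P)%N -> (forall i, padic_algebraic P`_i) ->
    exists2 x, padic_algebraic x & root P x;
  padic_algebraic_dense : forall x (e : R), 0 < e ->
    exists2 y, padic_algebraic y & nrm (x - y) < e }.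

(* These conditions determine [logp] on the nonzero elements; its value at [0]
   is unconstrained. *)
Record is_padic_log (logp : Cp -> Cp) : Prop := IsPadicLog {
  logpM : forall x y, x != 0 -> y != 0 -> logp (x * y) = logp x + logp y;
  logp_p : logp p%:R = 0;
  logp_series : forall x, nrm x < 1 ->
    nrm (\sum_(1 <= k < n) (-1) ^+ k.+1 * x ^+ k / k%:R - logp (1 + x))
      @[n --> \oo] --> (0 : R) }.

Definition coprime_lim (u : nat -> Cp) (l : Cp) : Prop :=
  nrm (u n - l) @[n --> within [set n | coprime n p] \oo] --> (0 : R).

Definition fixed_points d (X : Type) (act : 'rV[int]_d -> X -> X) (n : nat) :
    set X :=
  [set x | forall delta : 'rV[int]_d,
    (forall i, (n %| delta ord0 i)%Z) -> act delta x = x].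

(* [h_p(X)] exists and equals [h]; [c n] is the number of points fixed by
   [(nZ)^d]. *)
Definition padic_entropy (logp : Cp -> Cp) d (X : Type)
    (act : 'rV[int]_d -> X -> X) (h : Cp) : Prop :=
  exists c : nat -> nat,
    (forall n, coprime n p -> (fixed_points act n #= `I_(c n))%card) /\
    coprime_lim (fun n => logp (c n)%:R / (n ^ d)%:R) h.

Definition torus_torsion d (N : nat) : set 'rV[Cp]_d :=
  [set z | forall i, z 0 i ^+ N = 1].

(* [m_p(g)] exists and equals [m]; in particular all the logarithms in the
   defining sums are logarithms of nonzero elements. *)
Definition padic_mahler (logp : Cp -> Cp) d (g : laurent d Cp) (m : Cp) :
    Prop :=
  (forall N, coprime N p -> forall z, torus_torsion N z -> leval g z != 0) /\
  coprime_lim (fun N => (N ^ d)%:R^-1 *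
    \sum_(z \in torus_torsion N) logp (leval g z)) m.

End Padic.

(* Main.v *)
Require Import Defs.
From HB Require Import structures.
From mathcomp Require Import all_boot all_order all_algebra all_field.
From mathcomp Require Import finmap generic_quotient complex.
From mathcomp Require Import all_classical all_reals all_analysis.
From mathcomp Require Import ring.
From mathcomp Require cyclic.

Set Implicit Arguments.
Unset Strict Implicit.
Unset Printing Implicit Defensive.

Import Order.TTheory GRing.Theory Num.Theory.
Import numFieldNormedType.Exports.

Local Open Scope classical_set_scope.
Local Open Scope ring_scope.

(* Let B be the matrix of multiplication by f on the Laurent polynomials over O_K, with
   respect to an integral basis of O_K; it has entries in Z[t^{±1}] and determinant
   g = N(f), because the embeddings of K diagonalize it.

   A character of the quotient fixed by (nZ)^d is a family of numbers indexed by
   (Z/n)^d and the integral basis, killed by the block circulant matrix C_n of B. By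
   the Smith normal form there are |det C_n| of them, and the Fourier transform over
   C_p gives det C_n = prod_zeta g(zeta) over the n-torsion points. Taking log_p, the
   sequences defining the entropy and the Mahler measure coincide, so it remains to
   prove that the latter converges.

   Since g does not vanish on the p-adic torus, exactly one coefficient of g has
   maximal absolute value: Kronecker's substitution reduces this to one variable,
   where it follows by factoring, no root having absolute value 1. Hence
   g = c t^a (1 + h) with h of Gauss norm < 1, and log_p g(zeta) = log_p c +
   log_p(1 + h(zeta)). Expanding the logarithm, the average of h(zeta)^k over the
   n-torsion points is the constant coefficient of h^k for n large, and the remaining
   terms are uniformly small; so the averages converge to
   log_p c + sum_k (-1)^(k+1)/k (h^k)_0. *)

(** * Laurent polynomials *)

Section LaurentEvaluation.
Context (d : nat) (R : comNzRingType).
Implicit Types f g : laurent d R.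

Lemma laurent0E c : (0 : laurent d R) c = 0.
Proof. exact: fsfun0E. Qed.

Lemma laurentDE f g c : (f + g) c = f c + g c.
Proof. exact: laddE. Qed.

Lemma laurentNE f c : (- f) c = - f c.
Proof. exact: loppE. Qed.

Lemma laurentBE f g c : (f - g) c = f c - g c.
Proof. by rewrite laurentDE laurentNE. Qed.

Lemma laurentME f g c : (f * g) c = \sum_(a <- finsupp f) f a * g (c - a).
Proof. exact: lmulE. Qed.

Lemma laurent_sumE (I : Type) (r : seq I) (P : pred I) (F : I -> laurent d R) c :
  (\sum_(i <- r | P i) F i) c = \sum_(i <- r | P i) F i c.
Proof.
by elim/big_rec2: _ => [|i y x _ <-]; rewrite ?laurent0E ?laurentDE.
Qed.

Lemma lmonomD a b : lmonom (a + b) = lmonom a * lmonom b :> laurent d R.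
Proof.
apply/fsfunP => c; rewrite laurentME (@lsum_widen _ _ _ _ [fset a]%fset).
  by rewrite big_seq_fset1 !lmonomE eqxx mul1r subr_eq addrC.
apply/fsubsetP => e; rewrite mem_finsupp lmonomE inE.
by case: (e =P _) => // _; rewrite eqxx.
Qed.

Definition lconst (x : R) : laurent d R := [fsfun c in [fset 0%R]%fset => x].

Lemma lconstE x c : lconst x c = x *+ (c == 0).
Proof. by rewrite fsfunE inE; case: eqP. Qed.

Lemma lconstM x f c : (lconst x * f) c = x * f c.
Proof.
rewrite laurentME (@lsum_widen _ _ _ _ [fset 0%R]%fset).
  by rewrite big_seq_fset1 lconstE eqxx subr0.
apply/fsubsetP => e; rewrite mem_finsupp lconstE inE.
by case: (e =P _) => // _; rewrite eqxx.
Qed.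

Lemma lconst_zmod_morphism : zmod_morphism lconst.
Proof.
by move=> x y; apply/fsfunP => c; rewrite laurentBE !lconstE mulrnBl.
Qed.

Lemma lconst_monoid_morphism : monoid_morphism lconst.
Proof.
split=> [|x y]; apply/fsfunP => c; first by rewrite lconstE.
by rewrite lconstM !lconstE mulrnAr.
Qed.

HB.instance Definition _ :=
  GRing.isZmodMorphism.Build R (laurent d R) lconst lconst_zmod_morphism.
HB.instance Definition _ :=
  GRing.isMonoidMorphism.Build R (laurent d R) lconst lconst_monoid_morphism.

Lemma lmonomM a f c : (lmonom a * f) c = f (c - a).
Proof.
rewrite laurentME (@lsum_widen _ _ _ _ [fset a]%fset).
  by rewrite big_seq_fset1 lmonomE eqxx mul1r.
apply/fsubsetP => e; rewrite mem_finsupp lmonomE inE.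
by case: (e =P _) => // _; rewrite eqxx.
Qed.

Lemma laurent_expand f :
  f = \sum_(a <- finsupp f) lconst (f a) * lmonom a.
Proof.
apply/fsfunP => c; rewrite laurent_sumE.
under eq_bigr => a _ do rewrite lconstM lmonomE.
rewrite (@lsum_widen _ _ _ (fun a => (c == a)%:R) (c |` finsupp f)%fset) ?fsubsetU1 //.
have cA : c \in (c |` finsupp f)%fset by rewrite fset1U1.
rewrite (bigD1_seq c) ?fset_uniq //= eqxx mulr1 big1 ?addr0 // => a.
by rewrite eq_sym => /negPf->; rewrite mulr0.
Qed.

Section Lift.
Context (S : comNzRingType) (phi : {rmorphism R -> S}) (chi : 'rV[int]_d -> S).

(* The ring morphism determined by [phi] on coefficients and by [t^a |-> chi a],
   as soon as [chi] is multiplicative; evaluation and [lmap] are instances. *)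
Definition lev f : S := \sum_(a <- finsupp f) phi (f a) * chi a.

Lemma lev_widen f (A : {fset 'rV[int]_d}) : (finsupp f `<=` A)%fset ->
  lev f = \sum_(a <- A) phi (f a) * chi a.
Proof.
move=> fA; apply: big_fset_incl => // a _ /fsfun_dflt ->.
by rewrite rmorph0 mul0r.
Qed.

Lemma lev_zmod_morphism : zmod_morphism lev.
Proof.
move=> f g; pose A := (finsupp f `|` finsupp g)%fset.
rewrite (@lev_widen f A) ?fsubsetUl // (@lev_widen g A) ?fsubsetUr //.
rewrite (@lev_widen (f - g) A).
  by rewrite -sumrB; apply: eq_bigr => a _; rewrite laurentBE rmorphB mulrBl.
apply/fsubsetP => a; rewrite in_fsetU !mem_finsupp laurentBE.
by apply: contraNT; rewrite negb_or !negbK => /andP[/eqP-> /eqP->]; rewrite subr0.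
Qed.

HB.instance Definition _ :=
  GRing.isZmodMorphism.Build (laurent d R) S lev lev_zmod_morphism.

Lemma lev_const_monom x a : lev (lconst x * lmonom a) = phi x * chi a.
Proof.
rewrite (@lev_widen _ [fset a]%fset).
  by rewrite big_seq_fset1 lconstM lmonomE eqxx mulr1.
apply/fsubsetP => e; rewrite mem_finsupp lconstM lmonomE inE.
by case: (e =P a) => // _; rewrite mulr0 eqxx.
Qed.

Lemma lev_monom a : lev (lmonom a) = chi a.
Proof. by rewrite -[lmonom a]mul1r -(rmorph1 lconst) lev_const_monom rmorph1 mul1r. Qed.

Lemma lev_mul : chi 0 = 1 -> {morph chi : a b / a + b >-> a * b} ->
  monoid_morphism lev.
Proof.
move=> chi0 chiD; split=> [|f g]; first by rewrite lev_monom.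
rewrite {1}[f]laurent_expand {1}[g]laurent_expand mulr_suml raddf_sum.
rewrite [lev f]/lev mulr_suml; apply: eq_bigr => a _.
rewrite mulr_sumr raddf_sum [lev g]/lev mulr_sumr; apply: eq_bigr => b _ /=.
by rewrite mulrACA -rmorphM -lmonomD lev_const_monom rmorphM chiD mulrACA.
Qed.

End Lift.
End LaurentEvaluation.

Section LaurentMap.
Context (d : nat) (R S : comNzRingType) (phi : {rmorphism R -> S}).

Lemma lmapE (f : laurent d R) a : lmap phi f a = phi (f a).
Proof. by rewrite fsfunE; case: finsuppP => //= _; rewrite rmorph0. Qed.

Lemma lmap_zmod_morphism : zmod_morphism (lmap phi : laurent d R -> laurent d S).
Proof. by move=> f g; apply/fsfunP => c; rewrite laurentBE !lmapE laurentBE rmorphB. Qed.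

Lemma lmap_monoid_morphism : monoid_morphism (lmap phi : laurent d R -> laurent d S).
Proof.
split=> [|f g]; apply/fsfunP => c.
  by rewrite lmapE !lmonomE rmorph_nat.
rewrite laurentME lmapE laurentME (@lsum_widen _ _ (lmap phi f) _ (finsupp f)).
  by rewrite rmorph_sum; apply: eq_bigr => a _; rewrite rmorphM !lmapE.
apply/fsubsetP => a; rewrite !mem_finsupp lmapE; apply: contraNN => /eqP->.
by rewrite rmorph0.
Qed.

HB.instance Definition _ :=
  GRing.isZmodMorphism.Build (laurent d R) (laurent d S) (lmap phi) lmap_zmod_morphism.
HB.instance Definition _ :=
  GRing.isMonoidMorphism.Build (laurent d R) (laurent d S) (lmap phi) lmap_monoid_morphism.

Lemma finsupp_lmap (f : laurent d R) : (finsupp (lmap phi f) `<=` finsupp f)%fset.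
Proof.
apply/fsubsetP => a; rewrite !mem_finsupp lmapE; apply: contraNN => /eqP->.
by rewrite rmorph0.
Qed.

End LaurentMap.

Section LaurentPoint.
Context (d : nat) (F : fieldType).
Implicit Types (f g : laurent d F) (z : 'rV[F]_d).

Definition zpow z (a : 'rV[int]_d) : F := \prod_(i < d) z 0 i ^ a 0 i.

Lemma zpow0 z : zpow z 0 = 1.
Proof. by rewrite /zpow big1 // => i _; rewrite mxE expr0z. Qed.

Lemma zpowD z : (forall i, z 0 i != 0) ->
  {morph zpow z : a b / a + b >-> a * b}.
Proof.
move=> z0 a b; rewrite /zpow -big_split; apply: eq_bigr => i _.
by rewrite mxE expfzDr.
Qed.

Lemma levalE f z : leval f z = lev idfun (zpow z) f.
Proof. by []. Qed.

Lemma leval_lmap (R : comNzRingType) (phi : {rmorphism R -> F}) (f : laurent d R) z :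
  leval (lmap phi f) z = lev phi (zpow z) f.
Proof.
rewrite levalE (lev_widen _ _ (finsupp_lmap phi f)).
by apply: eq_bigr => a _; rewrite lmapE.
Qed.

(** Exponents may be negative, so [zpow z] is multiplicative only at nonzero coordinates; evaluation
    there commutes with products and powers. *)
Lemma leval_rmorph z : (forall i, z 0 i != 0) ->
  exists phi : {rmorphism laurent d F -> F}, forall f, phi f = leval f z.
Proof.
move=> z0; pose phi : {rmorphism laurent d F -> F} := HB.pack (lev idfun (zpow z))
  (GRing.isMonoidMorphism.Build _ _ _ (lev_mul idfun (zpow0 z) (zpowD z0))).
by exists phi.
Qed.

Lemma leval_const_monom x a z : leval (lconst d x * lmonom a) z = x * zpow z a.
Proof. by rewrite levalE lev_const_monom. Qed.

End LaurentPoint.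

(** * Circulant matrices and Fourier transform on the finite torus *)

Lemma prim_root_neq0 (F : fieldType) n (w : F) : n.-primitive_root w -> w != 0.
Proof.
move=> wP; apply/eqP => w0; have := prim_expr_order wP.
by rewrite w0 expr0n gtn_eqF ?(prim_order_gt0 wP) // => /eqP; rewrite eq_sym oner_eq0.
Qed.

Lemma det_castmx (R : comNzRingType) m n (e : m = n) (A : 'M[R]_m) :
  \det (castmx (e, e) A) = \det A.
Proof. by case: n / e; rewrite castmx_id. Qed.

Lemma det_mxdiag (R : comNzRingType) n (p : 'I_n -> nat)
    (D : forall i, 'M[R]_(p i)) :
  \det (\mxdiag_i D i) = \prod_(i < n) \det (D i).
Proof.
elim: n => [|n IHn] in p D *.
  (* The size is an empty sum; making the matrix opaque allows its size to be rewritten to [0]. *)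
  rewrite big_ord0 /mxdiag; set A := \mxblock_(_, _) _; clearbody A.
  by move: A; rewrite big_ord0 => A; rewrite det_mx00.
by rewrite mxdiag_recl det_castmx det_ublock IHn big_ord_recl.
Qed.

Section FiniteTorus.
(* [(Z/n)^d] is ['rV['I_m.+1]_d] with [n = m.+1]: unlike ['Z_n], the type ['I_n]
   is also correct for [n = 1]. *)
Context (d m : nat).
Local Notation n := m.+1.
Local Notation G := 'rV['I_n]_d.

Definition red (a : 'rV[int]_d) : G := \row_i ((Zp1 : 'I_n) *~ a 0 i).
Definition zlift (s : G) : 'rV[int]_d := \row_i (s 0 i : nat)%:Z.

Lemma redD : {morph red : a b / a + b}.
Proof. by move=> a b; apply/rowP => i; rewrite !mxE mulrzDr. Qed.

Lemma red0 : red 0 = 0.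
Proof. by apply/rowP => i; rewrite !mxE. Qed.

Lemma zliftK : cancel zlift red.
Proof.
move=> s; apply/rowP => i; rewrite !mxE -pmulrn Zp_mulrn.
by apply: val_inj; rewrite /= modnMml mul1n modn_small.
Qed.

Lemma red_eq0 a : (red a == 0) = [forall i, (n %| a ord0 i)%Z].
Proof.
have E (x : int) : ((Zp1 : 'I_n) *~ x == 0) = (n %| x)%Z.
  have E0 (k : nat) : ((Zp1 : 'I_n) *+ k == 0) = (n %| k)%N.
    by rewrite Zp_mulrn -val_eqE /= modnMml mul1n.
  case: x => k; first by rewrite -pmulrn E0.
  by rewrite NegzE mulrNz oppr_eq0 -pmulrn E0 rpredN.
apply/eqP/forallP => [a0 i|ai].
  by have /rowP/(_ i) := a0; rewrite !mxE => /eqP; rewrite E.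
by apply/rowP => i; rewrite !mxE; apply/eqP; rewrite E.
Qed.

Section Characters.
Context (F : fieldType) (w : F) (prim_w : n.-primitive_root w).

Let expwD (x y : 'I_n) : w ^+ (x + y)%R = w ^+ x * w ^+ y.
Proof. by rewrite /= (expr_mod _ (prim_expr_order prim_w)) exprD. Qed.

Let expw_mulz (z : int) : w ^+ ((Zp1 : 'I_n) *~ z)%R = w ^ z.
Proof.
have w0 := prim_root_neq0 prim_w.
have E (k : nat) : w ^+ ((Zp1 : 'I_n) *+ k)%R = w ^+ k.
  rewrite Zp_mulrn /= modnMml mul1n.
  exact: (expr_mod _ (prim_expr_order prim_w)).
case: z => k; first by rewrite -pmulrn E.
apply: (mulIf (expf_neq0 k.+1 w0)); rewrite NegzE -[in RHS]exprnN mulVf ?expf_neq0 //.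
by rewrite -[X in _ * X]E -expwD mulrNz -pmulrn addNr.
Qed.

Definition torus_pt (s : G) : 'rV[F]_d := \row_i w ^+ s 0 i.

Definition chr (s a : G) : F := \prod_i w ^+ (s 0 i * a 0 i).

Lemma torus_pt_neq0 s i : torus_pt s 0 i != 0.
Proof. by rewrite mxE expf_neq0 ?(prim_root_neq0 prim_w). Qed.

Lemma zpow_torus_pt s a : zpow (torus_pt s) a = chr s (red a).
Proof.
apply: eq_bigr => i _; rewrite !mxE mulnC exprM expw_mulz.
by rewrite !exprnP exprzAC.
Qed.

Lemma chrC s a : chr s a = chr a s.
Proof. by apply: eq_bigr => i _; rewrite mulnC. Qed.

Lemma chrDr s a b : chr s (a + b) = chr s a * chr s b.
Proof.
rewrite /chr -big_split; apply: eq_bigr => i _ /=.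
by rewrite !mxE !(mulnC (s 0 i)) !exprM expwD exprMn.
Qed.

Lemma chrDl s t a : chr (s + t) a = chr s a * chr t a.
Proof. by rewrite chrC chrDr !(chrC a). Qed.

Lemma chr0 a : chr 0 a = 1.
Proof. by rewrite /chr big1 // => i _; rewrite mxE mul0n. Qed.

(** Orthogonality of characters: for [s] nonzero the sum is multiplied by some [chr s t != 1] under
    translation by [t], hence is zero. *)
Lemma chr_sum s : \sum_a chr s a = (n ^ d)%:R * (s == 0)%:R.
Proof.
have [->|s0] := eqVneq s 0.
  under eq_bigr => a _ do rewrite chr0.
  by rewrite sumr_const card_mx card_ord mul1n mulr1.
rewrite mulr0; have [i si] : exists i, s 0 i != 0.
  apply/existsP; apply: contraR s0; rewrite negb_exists => /forallP H.
  by apply/eqP/rowP => i; rewrite mxE; apply/eqP; move: (H i); rewrite negbK.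
pose t : G := \row_j if j == i then Zp1 else 0.
have tE : chr s t = w ^+ s 0 i.
  rewrite /chr (bigD1 i) //= big1 => [|j ji].
    rewrite mulr1 mxE eqxx mulnC exprM /= (expr_mod _ (prim_expr_order prim_w)).
    by rewrite expr1.
  by rewrite mxE (negPf ji) muln0.
have t1 : chr s t != 1.
  rewrite tE -(expr0 w) (eq_prim_root_expr prim_w) mod0n modn_small //.
have : (1 - chr s t) * \sum_a chr s a = 0.
  rewrite mulrBl mul1r mulr_sumr (reindex_inj (addrI t)) /=.
  by under eq_bigr => a _ do rewrite chrDr; rewrite subrr.
by move/eqP; rewrite mulf_eq0 subr_eq0 eq_sym (negPf t1) => /eqP.
Qed.

Lemma prim_natf_neq0 : (n%:R : F) != 0.
Proof. exact: (prim_root_natf_neq0 prim_w). Qed.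

(** By orthogonality only exponents divisible by [n] contribute, and [n] exceeds every entry of the
    exponents in the support. *)
Lemma torus_average (P : laurent d F) :
  (\sum_(a <- finsupp P) \sum_i `|a ord0 i|%N < n)%N ->
  \sum_s leval P (torus_pt s) = (n ^ d)%:R * P 0.
Proof.
move=> Pn; rewrite /leval exchange_big.
transitivity (\sum_(a <- finsupp P) P a * ((n ^ d)%:R * (a == 0)%:R)).
  rewrite big_seq [RHS]big_seq; apply: eq_bigr => a aP; rewrite -mulr_sumr.
  congr (_ * _); under eq_bigr => s _ do rewrite -/(zpow _ a) zpow_torus_pt chrC.
  rewrite chr_sum; congr (_ * _%:R); have [->|a0] := eqVneq a 0.
    by rewrite red0 eqxx.
  rewrite red_eq0; apply/eqP; rewrite eqb0; apply/forallP => na.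
  case/eqP: a0; apply/rowP => i; rewrite mxE; apply/eqP; apply: contraTT (na i) => ai.
  apply/negP => /(dvdn_leq (_ : (0 < `|a ord0 i|)%N)); rewrite absz_gt0 ai => /(_ isT).
  rewrite leqNgt => /negP; apply; apply: leq_ltn_trans Pn.
  by rewrite (big_rem a) //= (bigD1 i) //= -addnA leq_addr.
rewrite (lsum_widen (fun a => (n ^ d)%:R * (a == 0)%:R) (fsubsetU1 0 (finsupp P))).
rewrite (bigD1_seq 0) ?fset_uniq ?fset1U1 //= eqxx mulr1 big1 ?addr0 1?mulrC // => a.
by move=> /negPf->; rewrite !mulr0.
Qed.

End Characters.

Section Circulant.
Context (r : nat) (B : 'M[laurent d int]_r).

(** The block from component [b] to component [a] of multiplication by [B] on [r] copies of the
    integral group ring of [(Z/n)^d]. *)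
Definition circulant_block (a b : G) : 'M[int]_r :=
  \matrix_(i, j) \sum_(c <- finsupp (B i j) | red c + b == a) B i j c.

Definition circulant : 'M[int]_(\sum_(k < #|G|) r) :=
  \mxblock_(k < #|G|, l < #|G|) circulant_block (enum_val k) (enum_val l).

(* The Fourier matrix [V] intertwines the block circulant matrix with the block
   diagonal matrix whose blocks are the values of [B] at the torsion points. *)
Lemma det_circulant (F : fieldType) (w : F) : n.-primitive_root w ->
  (\det circulant)%:~R =
  \prod_(s : G) leval (lmap intr (\det B)) (torus_pt w s) :> F.
Proof.
move=> prim_w.
pose D (s : G) := map_mx (lev intr (zpow (torus_pt w s))) B.
pose V := \mxblock_(k < #|G|, l < #|G|)
  ((chr w (enum_val k) (enum_val l))%:M : 'M[F]_r).
(* The inverse of [V] up to the factor [n ^ d], which is nonzero in [F]; hence [\det V] can be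
   cancelled from the intertwining relation. *)
pose W := \mxblock_(k < #|G|, l < #|G|)
  ((chr w (- enum_val k) (enum_val l))%:M : 'M[F]_r).
have WV : W *m V = (n ^ d)%:R%:M.
  rewrite -mxdiagZ mul_mxblock; apply/eq_mxblock => k l.
  under eq_bigr => q _ do rewrite -scalar_mxM.
  rewrite -raddf_sum /=.
  have -> : \sum_(q < #|{: G}|) chr w (- enum_val k) (enum_val q) *
      chr w (enum_val q) (enum_val l) = (n ^ d)%:R * (l == k)%:R.
    rewrite -(inj_eq enum_val_inj) -subr_eq0 addrC -(chr_sum prim_w).
    rewrite [RHS](big_enum_val (A := {: G})); apply: eq_bigr => q _.
    by rewrite (chrC _ (enum_val q)) -chrDl // chrC.
  have [_|_] := eqVneq k l; first by rewrite mulr1 conform_mx_id.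
  by rewrite mulr0 raddf0.
have VC : V *m map_mx intr circulant = \mxdiag_k D (enum_val k) *m V.
  have -> : map_mx intr circulant = \mxblock_(k < #|{: G}|, l < #|{: G}|)
      map_mx intr (circulant_block (enum_val k) (enum_val l)) :> 'M[F]__.
    by apply/matrixP => i j; rewrite !mxE.
  rewrite mul_mxblock mul_mxdiag_mxblock; apply/eq_mxblock => k l.
  apply/matrixP => i j; rewrite summxE mul_mx_scalar !mxE.
  transitivity (\sum_(a : G) chr w (enum_val k) a *
      (circulant_block a (enum_val l) i j)%:~R).
    rewrite [RHS](big_enum_val (A := {: G})); apply: eq_bigr => q _.
    by rewrite mul_scalar_mx !mxE.
  under eq_bigr => a _ do rewrite mxE rmorph_sum big_mkcond mulr_sumr.
  rewrite exchange_big mulr_sumr; apply: eq_bigr => c _ /=.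
  rewrite (bigD1 (red c + enum_val l)) //= eqxx big1 ?addr0 => [|a].
    by rewrite zpow_torus_pt // chrDr // [RHS]mulrCA mulrC [_ * chr _ _ (red c)]mulrC.
  by rewrite eq_sym => /negPf->; rewrite mulr0.
have V0 : \det V != 0.
  have /(congr1 determinant) := WV.
  rewrite det_mulmx det_scalar => /eqP; apply: contraTneq => ->.
  by rewrite mulr0 eq_sym expf_neq0 // natrX expf_neq0 // (prim_natf_neq0 prim_w).
have /(congr1 determinant) := VC.
rewrite !det_mulmx [RHS]mulrC => /(mulfI V0); rewrite det_map_mx => ->.
rewrite det_mxdiag [RHS](big_enum_val (A := {: G})); apply: eq_bigr => k _.
rewrite leval_lmap.
pose chi := zpow (torus_pt w (enum_val k)).
have chiD : {morph chi : a b / a + b >-> a * b}.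
  by apply: zpowD => i; exact: torus_pt_neq0.
pose phi : {rmorphism laurent d int -> F} := HB.pack (lev intr chi)
  (GRing.isMonoidMorphism.Build _ _ _ (lev_mul intr (zpow0 _) chiD)).
exact: (det_map_mx phi).
Qed.

End Circulant.
End FiniteTorus.

(** * Integral bases of number fields *)

Section Lattice.

(* Hermite reduction: among the vectors of [L] with positive first coordinate, one
   with minimal first coordinate splits off a copy of [Z]. *)
Lemma sublattice_basis r (L : set 'rV[int]_r) (D : int) : D != 0 ->
  L 0 -> (forall u v, L u -> L v -> L (u - v)) -> (forall v, L (D *: v)) ->
  exists W : 'M[int]_r, forall v, L v <-> exists u, v = u *m W.
Proof.
move=> D0; elim: r L => [|r IHr] L L0 LB LD.
  exists 0 => v; rewrite (thinmx0 v); split=> // _.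
  by exists 0; rewrite (thinmx0 (_ *m _)).
have LN v : L v -> L (- v) by move=> Lv; rewrite -[- v]add0r; apply: LB.
have LZ v (z : int) : L v -> L (z *: v).
  have LA (k : nat) : L v -> L (k%:Z *: v).
    move=> Lv; elim: k => [|k IHk]; first by rewrite scale0r.
    rewrite (intS k) scalerDl scale1r addrC -[X in _ + X]opprK.
    by apply: LB => //; exact: LN.
  case: z => k Lv; first exact: LA.
  by rewrite NegzE scaleNr; apply: LN; exact: LA.
pose P (k : nat) := (0 < k)%N && `[< exists2 v, L v & v 0 0 = k%:Z >].
(* [L] contains [D] times the first basis vector, so each step does split off a generator and [W] is
   square. *)
have exP : exists k, P k.
  exists `|D|%N; rewrite /P absz_gt0 D0; apply/asboolP.
  exists ((-1) ^+ (D < 0)%R *: (D *: \row_j (j == 0)%:R)); first exact: LZ.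
  by rewrite !mxE eqxx mulr1 abszEsign.
case: (ex_minnP exP) => e /andP[e0 /asboolP[v0 Lv0 v0e]] emin.
pose L' (u : 'rV[int]_r) := L (row_mx (0 : 'rV_1) u).
have L'0 : L' 0 by rewrite /L' row_mx0.
have L'B u v : L' u -> L' v -> L' (u - v).
  by move=> Lu Lv; rewrite /L' -[0](subrr 0) -add_row_mx -opp_row_mx; exact: LB.
have L'D v : L' (D *: v).
  by rewrite /L' -[0](scaler0 _ D) -scale_row_mx; exact: LD.
have [W' W'P] := IHr L' L'0 L'B L'D.
pose W : 'M[int]_(1 + r) := col_mx (v0 : 'rV_(1 + r)) (row_mx (0 : 'cV_r) W').
exists W => v; split=> [Lv|[u ->]]; last first.
  pose u' := rsubmx (u : 'rV_(1 + r)).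
  have -> : u *m W = lsubmx (u : 'rV_(1 + r)) *m (v0 : 'rV_(1 + r)) +
      u' *m row_mx (0 : 'cV_r) W'.
    by rewrite -mul_row_col hsubmxK.
  have Lu' : L (u' *m row_mx (0 : 'cV_r) W').
    by rewrite mul_mx_row mulmx0; apply/W'P; exists u'.
  rewrite [lsubmx _]mx11_scalar mul_scalar_mx addrC -[X in _ + X]opprK.
  by apply: LB => //; apply: LN; exact: LZ.
(* The remainder modulo [e] is again the first coordinate of a vector of [L]; minimality of [e]
   makes it zero. *)
pose q := (v ord0 ord0 %/ e)%Z; pose v1 : 'rV[int]_(1 + r) := v - q *: v0.
have Lv1 : L v1 by apply: LB => //; exact: LZ.
have v1E : v1 0 0 = (v ord0 ord0 %% e)%Z.
  by rewrite !mxE v0e {1}(divz_eq (v 0 0) e) addrAC subrr add0r.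
have v10 : v1 0 0 = 0.
  apply/eqP; apply: contraTT isT => v1n0.
  have e0z : e%:Z != 0 by case: (e) e0.
  have := ltz_mod (v 0 0) e0z; have := modz_ge0 (v 0 0) e0z.
  rewrite -v1E; case E: (v1 0 0) => [k|//] _; rewrite ltz_nat => ke.
  have : P k.
    rewrite /P lt0n; apply/andP; split; last by apply/asboolP; exists v1.
    by apply: contraNneq v1n0 => k0; rewrite E k0.
  by move/emin; rewrite leqNgt ke.
have v1R : v1 = row_mx (0 : 'M[int]_1) (rsubmx v1).
  rewrite -[LHS]hsubmxK; congr row_mx; rewrite [LHS]mx11_scalar mxE.
  rewrite (_ : lshift r 0 = 0) ?v10 ?raddf0 //; exact/val_inj.
have [u' u'E] : exists u', rsubmx v1 = u' *m W'.
  by apply/W'P; rewrite /L' -v1R.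
exists (row_mx (q%:M : 'M[int]_1) u').
transitivity ((q%:M : 'M[int]_1) *m (v0 : 'rV_(1 + r)) +
    u' *m row_mx (0 : 'cV_r) W').
  by rewrite mul_scalar_mx mul_mx_row mulmx0 -u'E -v1R addrC subrK.
apply: esym; exact: (mul_row_col (q%:M : 'M[int]_1) u').
Qed.

End Lattice.

(** * Integral elements of a field *)

Section Integrality.

(** Extends [alg_integer] to arbitrary fields, since conjugates and determinants in an algebraically
    closed field are needed too; the two are convertible on [K]. *)
Definition integral_pred (F : fieldType) : {pred F} :=
  fun x => `[< integralOver (intr : int -> F) x >].

Fact integral_pred_subring (F : fieldType) : subring_closed (@integral_pred F).
Proof.
split=> [|x y /asboolP xi /asboolP yi|x y /asboolP xi /asboolP yi].
- by apply/asboolP; exact: integral1.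
- by apply/asboolP; exact: integral_sub.
- by apply/asboolP; exact: integral_mul.
Qed.
HB.instance Definition _ (F : fieldType) :=
  GRing.isSubringClosed.Build F (@integral_pred F) (@integral_pred_subring F).

Lemma integral_pred_rmorph (F E : fieldType) (phi : {rmorphism F -> E}) x :
  x \in @integral_pred F -> phi x \in @integral_pred E.
Proof.
move=> /asboolP/(integral_rmorph phi); rewrite (_ : phi \o intr = intr).
  by move/asboolP.
by apply/funext => z /=; rewrite rmorph_int.
Qed.

Lemma integral_pred_int (F : fieldType) (z : int) : z%:~R \in @integral_pred F.
Proof. exact: rpred_int. Qed.

(* [a^(n-1) q(X/a)] is monic in [X] if [q] has degree [n] and leading coefficient [a]. *)
Lemma integral_lead_mul (F : fieldType) (q : {poly int}) (x : F) :
  root (map_poly intr q) x -> (lead_coef q)%:~R * x \in @integral_pred F.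
Proof.
move=> /rootP qx; have [q0|q0] := eqVneq q 0.
  by rewrite q0 lead_coef0 mul0r rpred0.
case sq: (size q) => [|n]; first by move/eqP: sq q0; rewrite size_poly_eq0 => ->.
have leadE : lead_coef q = q`_n by rewrite lead_coefE sq.
set a := lead_coef q in leadE *.
case: n => [|n] in sq leadE *.
  (* A nonzero constant has a root only if it vanishes in [F], which positive characteristic
     permits. *)
  rewrite (size1_polyC (eq_leq sq)) map_polyC hornerC -leadE /= in qx.
  by rewrite qx mul0r rpred0.
pose P0 : {poly int} := \poly_(i < n.+1) (q`_i * a ^+ (n - i)).
have sP : (size P0 < n.+2)%N by rewrite ltnS size_poly.
apply/asboolP; exists ('X^(n.+1) + P0).
  by rewrite monicE lead_coefDl ?size_polyXn ?lead_coefXn.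
apply/rootP; rewrite rmorphD /= map_polyXn hornerD hornerXn.
have sz1 : (size (map_poly intr P0 : {poly F}) <= n.+1)%N.
  exact: leq_trans (size_poly _ _) (size_poly _ _).
have sz2 : (size (map_poly intr q : {poly F}) <= n.+2)%N by rewrite -sq size_poly.
rewrite (horner_coef_wide _ sz1).
transitivity ((a%:~R) ^+ n * (map_poly intr q).[x]); last by rewrite qx mulr0.
rewrite (horner_coef_wide _ sz2).
rewrite [in RHS]big_ord_recr /= mulrDr addrC; congr (_ + _).
  rewrite mulr_sumr; apply: eq_bigr => i _.
  rewrite !coef_map coef_poly ltn_ord /= rmorphM rmorphXn /= exprMn.
  rewrite [RHS]mulrCA -!mulrA; congr (_ * _); rewrite mulrA -exprD subnK //.
  by rewrite -ltnS.
by rewrite coef_map /= -leadE exprMn exprSr mulrA.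
Qed.

(* [y] is minus the quotient by [X] of an integral equation of [x] with nonzero
   constant term, evaluated at [x]. *)
Lemma integral_divides_int (F : fieldType) (x : F) :
  (forall z : int, z != 0 -> z%:~R != 0 :> F) ->
  x \in @integral_pred F -> x != 0 ->
  exists2 y, y \in @integral_pred F & exists2 z : int, z != 0 & x * y = z%:~R.
Proof.
move=> charF xI x0; have /asboolP[p /monic_neq0 p0 px] := xI.
have [m [q q0 pE]] := multiplicity_XsubC p 0.
rewrite p0 /= in q0; rewrite pE rmorphM rmorphXn /= rmorphB /= map_polyX in px.
rewrite map_polyC /= rmorph0 subr0 rootM in px.
have qx : root (map_poly intr q) x.
  case/orP: px => // /rootP; rewrite hornerXn => /eqP.
  by rewrite expf_eq0 (negPf x0) andbF.
have q00 : q`_0 != 0 by rewrite -horner_coef0.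
pose q1 := drop_poly 1 q.
have qE : q = q1 * 'X + (q`_0)%:P.
  apply/polyP => -[|i]; rewrite coefD coefMX coefC ?add0r //=.
  by rewrite coef_drop_poly addn1 addr0.
exists (- (map_poly intr q1).[x]).
  rewrite rpredN horner_coef; apply: rpred_sum => i _; rewrite coef_map /=.
  by rewrite rpredM ?rpredX ?integral_pred_int.
exists (q`_0) => //; move: qx => /rootP; rewrite {1}qE rmorphD rmorphM /=.
rewrite map_polyX map_polyC hornerD hornerMX hornerC mulrN => /eqP.
by rewrite addrC addr_eq0 mulrC => /eqP.
Qed.

(** Transfer to [algC], where a rational algebraic integer is an integer. *)
Lemma rat_integral_int (q : rat) : q \in @integral_pred rat -> exists z : int, q = z%:~R.
Proof.
case/asboolP=> p p_mon /rootP p0.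
have : ratr q \in Aint.
  apply: (@root_monic_Aint (map_poly intr p)).
  - apply/rootP; rewrite (_ : map_poly intr p = map_poly ratr (map_poly intr p)).
      by rewrite horner_map p0 rmorph0.
    by rewrite -map_poly_comp; apply: eq_map_poly => z /=; rewrite ratr_int.
  - by rewrite monic_map.
  - by apply/polyOverP => i; rewrite coef_map; exact: rpred_int.
move/(Cint_rat_Aint (Crat_rat q))/intrP => [z qz]; exists z.
by move: qz; rewrite -ratr_int => /fmorph_inj.
Qed.

Lemma integral_ratr_int (F : numFieldType) (q : rat) :
  ratr q \in @integral_pred F -> exists z : int, q = z%:~R.
Proof.
case/asboolP=> p p_mon p0; apply: rat_integral_int; apply/asboolP; exists p => //.
rewrite -(fmorph_root (ratr : rat -> F)) -map_poly_comp.
by congr (root _ _): p0; apply: eq_map_poly => z /=; rewrite ratr_int.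
Qed.

End Integrality.

(** * Embeddings and integral bases *)

Section NumberField.
Context (K : fieldExtType rat).

Lemma fieldExt_rat_int_neq0 (z : int) : z != 0 -> z%:~R != 0 :> K.
Proof. by move=> z0; rewrite -(rmorph_int (in_alg K)) fmorph_eq0 intr_eq0. Qed.

(** Clear the denominators of the minimal polynomial, then multiply [x] by the resulting leading
    coefficient. *)
Lemma integral_multiple (x : K) :
  exists2 z : int, z != 0 & z%:~R * x \in @integral_pred K.
Proof.
have /polyOver1P[q qE] : minPoly 1 x \is a polyOver 1%VS := minPolyOver _ _.
have [q' [a a0 q'E]] := rat_poly_scale q.
have q'x : root (map_poly intr q') x.
  have := root_minPoly 1 x; rewrite qE q'E map_polyZ rootZ; last first.
    by rewrite fmorph_eq0 invr_eq0 intr_eq0.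
  rewrite -map_poly_comp; congr root; apply: eq_map_poly => z /=.
  exact: (rmorph_int (in_alg K)).
exists (lead_coef q'); last exact: integral_lead_mul.
rewrite lead_coef_eq0; apply/eqP => q'0; have := monic_minPoly 1 x.
by rewrite qE q'E q'0 !rmorph0 scaler0 rmorph0 monicE lead_coef0 eq_sym oner_eq0.
Qed.

(** The primitive element theorem holds in characteristic zero, and a nonzero integer multiple of a
    generator still generates. *)
Lemma integral_generator :
  exists2 t : K, t \in @integral_pred K & <<1; t>>%VS = fullv.
Proof.
have sep : separable 1 {:K}.
  apply/separableP => x _; apply: pcharf0_separable => p.
  by rewrite pchar_lalg pchar_num.
have := eq_adjoin_separable_generator sep (sub1v _).
set t := separable_generator _ _ => tE.
have [z z0 zt] := integral_multiple t.
exists (z%:~R * t) => //; apply/eqP; rewrite eqEsubv subvf /= {1}tE.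
apply/FadjoinP; split; first exact: sub1v.
have tZ : t = (z%:~R : rat)^-1 *: (z%:~R * t).
  by rewrite -(rmorph_int (in_alg K)) /= mulr_algl scalerA mulVf ?intr_eq0 // scale1r.
rewrite [X in X \in _]tZ; by apply: memvZ; exact: memv_adjoin.
Qed.

Variables (C : numClosedFieldType) (t : K).
Hypotheses (tI : t \in @integral_pred K) (tE : <<1; t>>%VS = fullv).

Let ev (q : {poly rat}) : K := (map_poly (in_alg K) q).[t].

Let ev_surj x : exists q, x = ev q.
Proof.
have : x \in <<1; t>>%VS by rewrite tE memvf.
by case/Fadjoin1_polyP=> q ->; exists q.
Qed.

Let min_poly : exists q : {poly rat}, minPoly 1 t = map_poly (in_alg K) q.
Proof. by apply/polyOver1P; exact: minPolyOver. Qed.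

Let m := sval (cid min_poly).
Let mE : minPoly 1 t = map_poly (in_alg K) m. Proof. by rewrite /m; case: cid. Qed.

Let m_monic : m \is monic.
Proof. by rewrite -(map_monic (in_alg K)) -mE monic_minPoly. Qed.

Let ev_eq0 q : ev q = 0 -> m %| q.
Proof.
move=> /rootP qt; rewrite -(dvdp_map (in_alg K)) -mE; apply: minPoly_dvdp => //.
exact: alg_polyOver.
Qed.

(** In characteristic zero the minimal polynomial is separable, so its roots in [C] are distinct;
    they will index the embeddings. *)
Let roots_exist : exists rs : seq C,
  uniq rs /\ map_poly ratr m = \prod_(a <- rs) ('X - a%:P).
Proof.
have [rs rsE] := closed_field_poly_normal (map_poly ratr m : {poly C}).
rewrite lead_coef_map (monicP m_monic) rmorph1 scale1r in rsE.
exists rs; split=> //; rewrite -separable_prod_XsubC -rsE separable_map.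
rewrite -(separable_map (in_alg K)) -mE; apply: pcharf0_separable => p.
by rewrite pchar_lalg pchar_num.
Qed.

Section Root.
Context (a : C) (ma : root (map_poly ratr m) a).

(** The polynomial representing [x] is an arbitrary choice; two choices differ by a multiple of [m],
    which vanishes at [a]. *)
Let tau (x : K) : C := (map_poly ratr (sval (cid (ev_surj x)))).[a].

Let tau_ev q : tau (ev q) = (map_poly ratr q).[a].
Proof.
rewrite /tau; case: cid => q' /= qq'.
have /ev_eq0/dvdpP[h hE] : ev (q' - q) = 0.
  by rewrite /ev rmorphB hornerD hornerN -/(ev q') -/(ev q) qq' subrr.
rewrite -[q'](subrK q) hE rmorphD rmorphM hornerD hornerM.
by rewrite (rootP ma) mulr0 add0r.
Qed.

Let tau_zmod : zmod_morphism tau.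
Proof.
move=> x y; have [[q ->] [h ->]] := (ev_surj x, ev_surj y).
have -> : ev q - ev h = ev (q - h) by rewrite /ev rmorphB hornerD hornerN.
by rewrite !tau_ev rmorphB hornerD hornerN.
Qed.

Let tau_monoid : monoid_morphism tau.
Proof.
split=> [|x y].
  have -> : 1 = ev 1 by rewrite /ev rmorph1 hornerC.
  by rewrite tau_ev rmorph1 hornerC.
have [[q ->] [h ->]] := (ev_surj x, ev_surj y).
have -> : ev q * ev h = ev (q * h) by rewrite /ev rmorphM hornerM.
by rewrite !tau_ev rmorphM hornerM.
Qed.

Lemma root_embedding : exists tau : {rmorphism K -> C}, tau t = a.
Proof.
pose f : {rmorphism K -> C} := HB.pack tau
  (GRing.isZmodMorphism.Build _ _ tau tau_zmod)
  (GRing.isMonoidMorphism.Build _ _ tau tau_monoid).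
exists f.
have tX : t = ev 'X by rewrite /ev map_polyX hornerX.
by rewrite {1}tX /= tau_ev map_polyX hornerX.
Qed.

End Root.

Lemma embedding_ev (tau : {rmorphism K -> C}) q : tau (ev q) = (map_poly ratr q).[tau t].
Proof.
rewrite /ev -horner_map -map_poly_comp; congr _.[_]; apply: eq_map_poly => x /=.
by rewrite alg_num_field fmorph_rat.
Qed.

Lemma embedding_root (tau : {rmorphism K -> C}) : root (map_poly ratr m) (tau t).
Proof.
by apply/rootP; rewrite -embedding_ev /ev -mE minPolyxx rmorph0.
Qed.

(* By Cramer's rule for the Vandermonde matrix [E0] of the conjugates of [t], the
   coordinates of an integer on the powers of [t] become integral after
   multiplication by [\det E0], hence, after multiplication by a nonzero integer
   multiple [D] of [\det E0], they are rational integers: the ring of integers lies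
   between [Z[t]] and [1/D Z[t]], and is free as a lattice containing [D Z[t]]. *)
Lemma integral_basis_of_generator : exists (r : nat) (tau : 'I_r -> {rmorphism K -> C})
    (w : 'I_r -> int_ring K),
  [/\ injective (fun k => tau k : K -> C),
      forall s : {rmorphism K -> C}, exists k, tau k = s :> (K -> C),
      forall x : int_ring K, exists u : 'rV[int]_r, x = \sum_i w i *~ u 0 i
    & (\matrix_(k, i) tau k (w i : K)) \in unitmx].
Proof.
have [rs [rs_uniq mrs]] := roots_exist.
pose r := size rs.
have root_rs (k : 'I_r) : root (map_poly ratr m) (rs`_k).
  by rewrite mrs root_prod_XsubC mem_nth.
have [tau tauE] := choice (fun k => root_embedding (root_rs k)).
have tau_inj : injective (fun k => tau k : K -> C).
  move=> k l kl; apply/val_inj/eqP => /=; rewrite -(nth_uniq 0 _ _ rs_uniq) //.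
  by rewrite -!tauE; apply/eqP; rewrite (congr1 (@^~ t) kl).
have tau_surj (s : {rmorphism K -> C}) : exists k, tau k = s :> (K -> C).
  have : s t \in rs by rewrite -root_prod_XsubC -mrs embedding_root.
  move=> /(nthP 0)[k kr sk]; exists (Ordinal kr); apply/funext => x.
  by have [q ->] := ev_surj x; rewrite !embedding_ev tauE /= sk.
have sm : size m = r.+1.
  by rewrite -(size_map_poly (ratr : {rmorphism rat -> C})) mrs size_prod_XsubC.
have tau_pow k (q : nat -> rat) :
    tau k (\sum_(j < r) (q j)%:A * t ^+ j) = \sum_(j < r) rs`_k ^+ j * ratr (q j).
  rewrite rmorph_sum; apply: eq_bigr => j _; rewrite rmorphM rmorphXn tauE.
  by rewrite alg_num_field fmorph_rat mulrC.
pose E0 : 'M[C]_r := \matrix_(k, j) rs`_k ^+ j.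
have E0I k j : E0 k j \in @integral_pred C.
  by rewrite mxE rpredX // -tauE integral_pred_rmorph.
have detI n (A : 'M[C]_n) : (forall i j, A i j \in @integral_pred C) ->
    \det A \in @integral_pred C.
  move=> AI; apply: rpred_sum => s _; rewrite rpredM ?rpredX ?rpredN ?rpred1 //.
  exact: rpred_prod.
have E0det : \det E0 != 0.
  rewrite -det_tr (_ : E0^T = Vandermonde r (\row_k rs`_k)); last first.
    by apply/matrixP => i j; rewrite !mxE.
  rewrite det_Vandermonde; apply/prodf_neq0 => i _; apply/prodf_neq0 => j ij.
  by rewrite !mxE subr_eq0 nth_uniq // gtn_eqF.
have intrC (z : int) : z != 0 -> z%:~R != 0 :> C by rewrite intr_eq0.
have [e eI [D D0 eD]] := integral_divides_int intrC (detI _ _ E0I) E0det.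
pose tsum (v : 'rV[int]_r) : K := \sum_(j < r) (v 0 j)%:~R * t ^+ j.
have coords (x : int_ring K) : exists v, D%:~R * (x : K) = tsum v.
  have [q0 q0E] := ev_surj x; pose q := q0 %% m.
  have qE : (x : K) = \sum_(j < r) (q`_j)%:A * t ^+ j.
    rewrite q0E (divp_eq q0 m) -/q /ev rmorphD rmorphM hornerD hornerM /=.
    rewrite -mE minPolyxx mulr0 add0r (@horner_coef_wide _ r).
      by apply: eq_bigr => j _; rewrite coef_map.
    rewrite size_map_poly -ltnS -sm ltn_modp -size_poly_eq0 sm //.
  have qI (j : 'I_r) : exists z : int, D%:~R * q`_j = z%:~R.
    apply: (@integral_ratr_int C).
    pose c : 'cV[C]_r := \col_i ratr q`_i.
    have E0c k : (E0 *m c) k 0 = tau k (x : K).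
      by rewrite qE tau_pow mxE; apply: eq_bigr => i _; rewrite !mxE.
    have -> : ratr (D%:~R * q`_j) = e * (\adj E0 *m (E0 *m c)) j 0.
      rewrite mulmxA mul_adj_mx mul_scalar_mx !mxE mulrA [e * _]mulrC eD.
      by rewrite rmorphM rmorph_int.
    rewrite rpredM // mxE; apply: rpred_sum => k _; rewrite E0c rpredM //.
      rewrite mxE /cofactor rpredM ?rpredX ?rpredN ?rpred1 //.
      by apply: detI => i l; rewrite !mxE -[rs`_ _]tauE rpredX // integral_pred_rmorph.
    by apply: integral_pred_rmorph; case: (x).
  have [z zE] := choice qI; exists (\row_j z j).
  rewrite qE mulr_sumr; apply: eq_bigr => j _; rewrite mxE mulrA; congr (_ * _).
  rewrite -(rmorph_int (in_alg K)) -(rmorph_int (in_alg K) (z j)) -zE.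
  by rewrite -[_%:A]/(in_alg K q`_j) -rmorphM.
have tsumB u v : tsum (u - v) = tsum u - tsum v.
  by rewrite /tsum -sumrB; apply: eq_bigr => j _; rewrite !mxE rmorphB mulrBl.
have tsumZ z v : tsum (z *: v) = z%:~R * tsum v.
  by rewrite /tsum mulr_sumr; apply: eq_bigr => j _; rewrite mxE rmorphM mulrA.
have tsumI v : tsum v \in @alg_integer K.
  by apply: rpred_sum => j _; rewrite rpredM ?rpredX ?integral_pred_int.
(* Multiplication by [D] gives every integer of [K] integral coordinates on the powers of [t]. As
   these powers are integral, [L] contains [D] times each vector. *)
pose L (v : 'rV[int]_r) := exists x : int_ring K, D%:~R * (x : K) = tsum v.
have L0 : L 0.
  by exists 0; rewrite mulr0 /tsum big1 // => j _; rewrite mxE mul0r.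
have LB u v : L u -> L v -> L (u - v).
  by move=> [x xE] [y yE]; exists (x - y); rewrite tsumB -xE -yE -mulrBr.
have LD v : L (D *: v) by exists (IntRing (tsumI v)); rewrite tsumZ.
have [W WP] := sublattice_basis D0 L0 LB LD.
have LW i : L (row i W) by apply/WP; exists (delta_mx 0 i); rewrite rowE.
have [w wE] := choice LW.
have DK : D%:~R != 0 :> K := fieldExt_rat_int_neq0 D0.
exists r, tau, w; split=> // [x|].
  have [v vE] := coords x.
  have /WP[u uE] : L v by exists x.
  exists u; apply/val_inj/(mulfI DK); transitivity (tsum v); first exact: vE.
  rewrite uE.
  rewrite (raddf_sum (val : int_ring K -> K)) mulr_sumr /tsum.
  under eq_bigr => j _ do rewrite mxE rmorph_sum mulr_suml.
  rewrite exchange_big; apply: eq_bigr => i _.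
  rewrite (raddfMz (val : int_ring K -> K)) /= -[(w i : K) *~ _]mulrzr mulrA wE mulr_suml.
  by apply: eq_bigr => j _; rewrite mxE rmorphM [RHS]mulrC mulrA.
pose E : 'M[C]_r := \matrix_(k, i) tau k (w i : K).
have DE : D%:~R *: E = E0 *m (map_mx intr W)^T.
  apply/matrixP => k i; rewrite !mxE -(rmorph_int (tau k)) -rmorphM wE.
  rewrite rmorph_sum; apply: eq_bigr => j _; rewrite !mxE rmorphM rmorphXn.
  by rewrite tauE rmorph_int mulrC.
(* The rows of [D%:M] lie in [L], so some integral matrix times [W] equals [D%:M]. *)
have detW : \det W != 0.
  have [U UE] := choice (fun i => (WP _).1 (LD (delta_mx 0 i))).
  have /(congr1 determinant) : (\matrix_i U i) *m W = D%:M.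
    apply/row_matrixP => i; rewrite row_mul rowK -UE.
    by rewrite -scalemx1 linearZ /= row1.
  rewrite det_mulmx det_scalar => /eqP; apply: contraTneq => ->.
  by rewrite mulr0 eq_sym expf_neq0.
rewrite -/E unitmxE unitfE; move: (congr1 determinant DE).
rewrite detZ det_mulmx det_tr det_map_mx => /eqP; apply: contraTneq => ->.
by rewrite mulr0 eq_sym mulf_neq0 // intr_eq0.
Qed.

End NumberField.

Lemma integral_basis (K : fieldExtType rat) (C : numClosedFieldType) :
  exists (r : nat) (tau : 'I_r -> {rmorphism K -> C}) (w : 'I_r -> int_ring K),
  [/\ injective (fun k => tau k : K -> C),
      forall s : {rmorphism K -> C}, exists k, tau k = s :> (K -> C),
      forall x : int_ring K, exists u : 'rV[int]_r, x = \sum_i w i *~ u 0 i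
    & (\matrix_(k, i) tau k (w i : K)) \in unitmx].
Proof.
have [t tI tE] := integral_generator K; exact: integral_basis_of_generator tI tE.
Qed.

(** * The norm as a determinant *)

Lemma fsbig_finType (T : Type) (idx : T) (op : Monoid.com_law idx) (I : finType)
    (F : I -> T) :
  \big[op/idx]_(i \in [set: I]) F i = \big[op/idx]_(i : I) F i.
Proof.
rewrite fsbig_finite //=; apply: perm_big; apply: uniq_perm.
- exact: fset_uniq.
- exact: index_enum_uniq.
move=> i; rewrite mem_index_enum in_fset_set; last exact: finite_finset.
by rewrite mem_set.
Qed.

Section NormMatrix.
Context (R : realType) (K : fieldExtType rat) (d : nat).

Lemma int_of_complexK : cancel (intr : int -> R[i]) (@int_of_complex R).
Proof.
move=> z; rewrite /int_of_complex; apply: xget_unique => //= y /eqP.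
by rewrite eqr_int => /eqP.
Qed.

(** [int_of_complex] is not additive, so [lmapE] covers only the inner [lmap]; exponents off the
    support are treated apart. *)
Lemma lmap_intrK : cancel (lmap intr) (lmap (@int_of_complex R) : _ -> laurent d int).
Proof.
move=> g; apply/fsfunP => c; rewrite fsfunE; case: finsuppP => /= [cN|_].
  by apply/esym/eqP; rewrite -(eqr_int R[i]) -lmapE (fsfun_dflt cN).
by rewrite lmapE int_of_complexK.
Qed.

(* [B] is the matrix of multiplication by [f]; the matrix [E] of the embeddings of
   the basis diagonalizes it, with diagonal entries [tau f]. This shows at the same
   time that the coefficients of the norm are integers. *)
Lemma lnorm_det (f : laurent d (int_ring K)) :
  exists (r : nat) (w : 'I_r -> int_ring K) (B : 'M[laurent d int]_r),
  [/\ forall x : int_ring K, exists u : 'rV[int]_r, x = \sum_i w i *~ u 0 i,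
      forall u v : 'rV[int]_r,
        \sum_i w i *~ u 0 i = \sum_i w i *~ v 0 i -> u = v,
      forall j c, f c * w j = \sum_i w i *~ B i j c
    & lnorm R f = \det B].
Proof.
have [r [tau [w [tau_inj tau_surj w_gen Eunit]]]] := integral_basis K R[i].
set E := \matrix_(k, i) _ in Eunit.
pose tv k : {rmorphism int_ring K -> R[i]} := (tau k \o val)%FUN.
have tv_sum k (u : 'rV[int]_r) :
    tv k (\sum_i w i *~ u 0 i) = (E *m (map_mx intr u)^T) k 0.
  rewrite raddf_sum mxE; apply: eq_bigr => i _.
  by rewrite raddfMz !mxE -mulrzr.
(* Applying all embeddings multiplies the coordinate vector by the invertible matrix [E]. *)
have w_free (u v : 'rV[int]_r) :
    \sum_i w i *~ u 0 i = \sum_i w i *~ v 0 i -> u = v.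
  move=> uv; have : E *m (map_mx intr u)^T = E *m (map_mx intr v)^T.
    by apply/matrixP => k j; rewrite ord1 -!tv_sum uv.
  move/(congr1 (mulmx (invmx E))); rewrite !mulKmx // => /trmx_inj.
  by move=> /rowP uv'; apply/rowP => i; have := uv' i; rewrite !mxE => /intr_inj.
have [coord coordE] := choice w_gen.
have coord0 : coord 0 = 0.
  by apply: w_free; rewrite -coordE big1 // => i _; rewrite mxE mulr0z.
pose B : 'M[laurent d int]_r :=
  \matrix_(i, j) [fsfun c in finsupp f => coord (f c * w j) 0 i].
have BE i j c : B i j c = coord (f c * w j) 0 i.
  rewrite mxE fsfunE; case: finsuppP => //= _.
  by rewrite mul0r coord0 mxE.
exists r, w, B; split=> // [j c|].
  by rewrite [LHS]coordE; apply: eq_bigr => i _; rewrite BE.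
rewrite /lnorm -[RHS]lmap_intrK; congr lmap; rewrite -det_map_mx.
pose Ec := map_mx (@lconst d R[i]) E.
pose F := \row_k lmap (tv k) f.
(* Each row of [Ec] is a left eigenvector of [B] with eigenvalue [tau f], because [tau] is
   multiplicative on [f c * w j]. *)
have EB : Ec *m map_mx (lmap intr) B = diag_mx F *m Ec.
  apply/matrixP => k j; apply/fsfunP => c.
  rewrite mul_diag_mx !mxE laurent_sumE mulrC lconstM lmapE mulrC.
  transitivity (tv k (f c * w j)); last by rewrite rmorphM.
  rewrite [f c * w j]coordE tv_sum mxE; apply: eq_bigr => i _.
  rewrite [(map_mx intr _)^T i 0]mxE [map_mx intr _ 0 i]mxE -BE.
  by rewrite !mxE lconstM lmapE.
have detE : lconst d (\det E) * lconst d (\det E)^-1 = 1.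
  by rewrite -rmorphM divrr ?rmorph1 // -unitmxE.
have /(congr1 (fun M => \det M * lconst d (\det E)^-1)) := EB.
rewrite !det_mulmx [\det Ec]det_map_mx mulrAC detE mul1r -mulrA detE mulr1 => ->.
rewrite det_diag /complex_norm.
(* [embeddings] is a set of plain functions; [tau] enumerates it without repetition. *)
rewrite (@reindex_fsbig _ _ _ _ _ (fun k => tau k : K -> R[i]) [set: 'I_r]).
  rewrite fsbig_finType; apply: eq_bigr => k _; rewrite mxE.
  by [].
split.
- by move=> k _; exact: (imageT (fun s : {rmorphism K -> R[i]} => s : K -> R[i])).
- by move=> k l _ _; exact: tau_inj.
- by move=> _ [s _ <-]; have [k] := tau_surj s; exists k.
Qed.

End NormMatrix.

(** * Counting fixed points *)

Section RootsOfUnity.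

(** As [n] is nonzero in [F], [X^n - 1] is separable and has [n] distinct roots; a finite group of
    roots of unity in a field is cyclic. *)
Lemma prim_root_of_split (F : fieldType) n (rs : seq F) : (n%:R : F) != 0 ->
  'X^n - 1 = \prod_(a <- rs) ('X - a%:P) -> exists w : F, n.-primitive_root w.
Proof.
case: n => [|n] n0 rsE; first by rewrite eqxx in n0.
have rs_uniq : uniq rs.
  rewrite -separable_prod_XsubC -rsE; exact: separable_Xn_sub_1.
have rs_root : all n.+1.-unity_root rs.
  by apply/allP => a ars; rewrite /root_of_unity rsE root_prod_XsubC.
have rs_size : (n.+1 <= size rs)%N.
  by rewrite -ltnS -(size_prod_XsubC rs id) -rsE size_XnsubC.
have /hasP[w _ wP] := cyclic.has_prim_root (ltn0Sn n) rs_root rs_uniq rs_size.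
by exists w.
Qed.

Lemma closed_prim_root (C : numClosedFieldType) n : (0 < n)%N ->
  exists w : C, n.-primitive_root w.
Proof.
move=> n0; have [rs] := closed_field_poly_normal ('X^n - 1 : {poly C}).
rewrite (monicP (monicXnsubC _ n0)) scale1r => /prim_root_of_split; apply.
by rewrite pnatr_eq0 -lt0n.
Qed.

End RootsOfUnity.

(** * Kernels of monomial maps of complex tori *)

Section MonomialMap.
Context (C : numClosedFieldType).

(* The morphism of tori given by the monomials whose exponents are the columns of [A]. *)
Definition mpow m n (u : 'rV[C]_m) (A : 'M[int]_(m, n)) : 'rV[C]_n :=
  \row_j \prod_i u 0 i ^ A i j.

Definition nonvanishing n (u : 'rV[C]_n) := forall i, u 0 i != 0.

Lemma mpow_neq0 m n (u : 'rV[C]_m) (A : 'M[int]_(m, n)) :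
  nonvanishing u -> nonvanishing (mpow u A).
Proof.
by move=> u0 j; rewrite mxE; apply/prodf_neq0 => i _; exact: expfz_neq0.
Qed.

Lemma mpowM m n k (u : 'rV[C]_m) (A : 'M[int]_(m, n)) (B : 'M[int]_(n, k)) :
  nonvanishing u -> mpow (mpow u A) B = mpow u (A *m B).
Proof.
move=> u0; apply/rowP => j; rewrite !mxE.
have prodz (I : Type) (s : seq I) (P : pred I) (F : I -> C) z :
    (\prod_(i <- s | P i) F i) ^ z = \prod_(i <- s | P i) F i ^ z.
  by apply: (big_morph (@exprz C ^~ z)) => [x y|]; rewrite ?exp1rz ?expfzMl.
under eq_bigr => l _ do rewrite mxE prodz.
rewrite exchange_big; apply: eq_bigr => i _ /=.
rewrite mxE (big_morph (exprz (u 0 i)) (op1 := *%R) (id1 := 1)) ?expr0z //.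
  by apply: eq_bigr => l _; rewrite exprz_exp.
by move=> x y; rewrite expfzDr.
Qed.

Lemma mpow1 n (u : 'rV[C]_n) : mpow u 1%:M = u.
Proof.
apply/rowP => j; rewrite mxE (bigD1 j) //= mxE eqxx expr1z big1 ?mulr1 // => i ij.
by rewrite mxE (negPf ij) expr0z.
Qed.

Lemma mpow_const1 m n (A : 'M[int]_(m, n)) : mpow (const_mx 1) A = const_mx 1.
Proof. by apply/rowP => j; rewrite !mxE big1 // => i _; rewrite mxE exp1rz. Qed.

Definition mpow_ker n (A : 'M[int]_n) : set 'rV[C]_n :=
  [set u | nonvanishing u /\ mpow u A = const_mx 1].

Lemma card_setT_fin (T : finType) : ([set: T] #= `I_#|T|)%card.
Proof.
have inj : {in [set: 'I_#|T|] &, injective (@enum_val T T)}.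
  by move=> x y _ _; exact: enum_val_inj.
have := inj_card_eq inj; rewrite (_ : _ @` _ = [set: T]); last first.
  by apply/seteqP; split=> // x _; exists (enum_rank x) => //; exact: enum_rankK.
by move/card_eq_trans; apply; rewrite card_eq_sym; exact: card_II.
Qed.

Lemma absz_unit (z : int) : z \is a GRing.unit -> `|z|%N = 1%N.
Proof.
move=> /mulrV/(congr1 absz); rewrite abszM absz1 => /eqP.
by rewrite muln_eq1 => /andP[/eqP].
Qed.

(* Smith normal form reduces the system to [v_i ^ e_i = 1]. *)
Lemma card_mpow_ker n (A : 'M[int]_n) : \det A != 0 ->
  (mpow_ker A #= `I_(`|\det A|%N))%card.
Proof.
have [L Lunit [Q Qunit [e _ AE]]] := int_Smith_normal_form A.
set D := \matrix_(i, j) _ in AE.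
have detD : \det D = \prod_(i < n) e`_i.
  have -> : D = diag_mx (\row_i e`_i) by apply/matrixP => i j; rewrite !mxE.
  by rewrite det_diag; apply: eq_bigr => i _; rewrite mxE.
pose a (i : 'I_n) : nat := absz e`_i.
have -> : `|\det A|%N = (\prod_(i < n) a i)%N.
  rewrite AE !det_mulmx !abszM (absz_unit (z := \det L)) -?unitmxE // mul1n.
  rewrite (absz_unit (z := \det Q)) -?unitmxE // muln1.
  by rewrite detD (big_morph absz abszM absz1).
rewrite AE !det_mulmx !mulf_eq0 !negb_or detD => /andP[/andP[_ /prodf_neq0 e0] _].
have a_gt0 i : (0 < a i)%N by rewrite absz_gt0 e0.
have [w wP] := choice (fun i => closed_prim_root C (a_gt0 i)).
(* [T] parametrizes the solutions of the diagonal system by exponents of the primitive roots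
   [w i]. *)
pose T := fprod (fun i : 'I_n => 'I_(a i)).
pose v (x : T) : 'rV[C]_n := \row_i w i ^+ x i.
have v_neq0 x : nonvanishing (v x).
  by move=> i; rewrite mxE expf_neq0 // (prim_root_neq0 (wP i)).
have mpowD u : mpow u D = \row_j u 0 j ^ e`_j.
  apply/rowP => j; rewrite !mxE (bigD1 j) //= mxE eqxx mulr1n big1 ?mulr1 // => i ij.
  by rewrite mxE val_eqE (negPf ij) mulr0n expr0z.
have exprz1 (x : C) (z : int) : (x ^ z == 1) = (x ^+ `|z| == 1).
  by case: z => k //; rewrite NegzE -exprnN invr_eq1.
have Lu := mulmxV Lunit; have Lu' := mulVmx Lunit.
have Qu := mulmxV Qunit.
have card_T : ([set: T] #= `I_(\prod_(i < n) a i)%N)%card.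
  suff -> : (\prod_(i < n) a i = #|{: T}|)%N by exact: card_setT_fin.
  by rewrite card_fprod; apply: eq_bigr => i _; rewrite card_ord.
(* [L] changes coordinates on the source; [Q] acts on the target and, being invertible, preserves
   the equations. *)
pose g x := mpow (v x) (invmx L).
have g_inj : {in [set: T] &, injective g}.
  move=> x y _ _ /(congr1 (fun u => mpow u L)); rewrite !mpowM // Lu' !mpow1 => vxy.
  apply/fprodP => i; have /rowP/(_ i) := vxy; rewrite !mxE => /eqP.
  rewrite (eq_prim_root_expr (wP i)) !modn_small // => /eqP; exact: val_inj.
rewrite -AE; suff -> : mpow_ker A = g @` [set: T].
  exact: card_eq_trans (inj_card_eq g_inj) card_T.
apply/seteqP; split=> [u [u0 uA]|_ [x _ <-]]; last first.
  split; first exact: mpow_neq0.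
  rewrite /g AE mpowM // !mulmxA Lu' mul1mx -mpowM // mpowD.
  rewrite (_ : \row__ _ = const_mx 1) ?mpow_const1 //.
  apply/rowP => j; rewrite !mxE; apply/eqP; rewrite exprz1 -exprM mulnC exprM.
  by rewrite (prim_expr_order (wP j)) expr1n.
have uLD j : (mpow u L) 0 j ^+ a j = 1.
  have : mpow u (A *m invmx Q) = const_mx 1 by rewrite -mpowM // uA mpow_const1.
  rewrite AE -!mulmxA Qu mulmx1 -mpowM // mpowD => /rowP/(_ j); rewrite !mxE => /eqP.
  by rewrite exprz1 => /eqP.
exists [fprod j => sval (prim_rootP (wP j) (uLD j))] => //; rewrite /g.
rewrite (_ : v _ = mpow u L) ?mpowM // ?Lu ?mpow1 //.
by apply/rowP => j; rewrite [in LHS]mxE fprodE; case: prim_rootP.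
Qed.

End MonomialMap.

Section MultiplicativeCharacter.
Context (V : zmodType) (C : fieldType) (psi : V -> C).
Hypotheses (psiD : {morph psi : x y / x + y >-> x * y})
  (psi_neq0 : forall x, psi x != 0).

Lemma mulchar0 : psi 0 = 1.
Proof. by apply: (mulIf (psi_neq0 0)); rewrite mul1r -psiD addr0. Qed.

Lemma mulchar_sum (I : Type) (s : seq I) (P : pred I) (F : I -> V) :
  psi (\sum_(i <- s | P i) F i) = \prod_(i <- s | P i) psi (F i).
Proof. exact: (big_morph psi psiD mulchar0). Qed.

Lemma mulcharMz x z : psi (x *~ z) = psi x ^ z.
Proof.
have E (k : nat) : psi (x *+ k) = psi x ^+ k.
  by elim: k => [|k IHk]; rewrite ?mulchar0 // mulrS psiD IHk exprS.
case: z => k; first exact: E.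
apply: (mulIf (expf_neq0 k.+1 (psi_neq0 x))).
by rewrite NegzE -exprnN mulVf ?expf_neq0 // -E -psiD mulrNz -pmulrn addNr mulchar0.
Qed.

End MultiplicativeCharacter.

Lemma character_ext (R : realType) (M : zmodType) (x y : pontryagin_dual R M) :
  (x : M -> R[i]) = y -> x = y.
Proof.
case: x y => [x xD x1] [y yD y1] /= xy; case: y / xy in yD y1 *.
by congr Character; exact: Prop_irrelevance.
Qed.

(** * Fixed characters as the kernel of a monomial map *)

Section FixedPoints.
Context (R : realType) (d m r : nat) (A : comNzRingType) (w : 'I_r -> A).
Context (f : laurent d A) (B : 'M[laurent d int]_r).
Hypotheses
  (w_gen : forall x, exists u : 'rV[int]_r, x = \sum_i w i *~ u 0 i)
  (w_free : forall u v : 'rV[int]_r,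
     \sum_i w i *~ u 0 i = \sum_i w i *~ v 0 i -> u = v)
  (fwE : forall j c, f c * w j = \sum_i w i *~ B i j c).
Local Notation n := m.+1.
Local Notation G := 'rV['I_n]_d.
Local Notation C := R[i].

Let coord x := sval (cid (w_gen x)).

Let coordE x : x = \sum_i w i *~ coord x 0 i.
Proof. by rewrite /coord; case: cid. Qed.

Let coord_unique x (u : 'rV[int]_r) : x = \sum_i w i *~ u 0 i -> coord x = u.
Proof. by rewrite {1}[x]coordE; exact: w_free. Qed.

Let coordD x y : coord (x + y) = coord x + coord y.
Proof.
apply: coord_unique; rewrite {1}[x]coordE {1}[y]coordE -big_split.
by apply: eq_bigr => i _; rewrite mxE mulrzDr.
Qed.

Let coord0 : coord 0 = 0.
Proof. by apply: (addrI (coord 0)); rewrite -coordD !addr0. Qed.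

Let coord_w j : coord (w j) = delta_mx 0 j.
Proof.
apply: coord_unique; rewrite (bigD1 j) //= mxE !eqxx big1 ?addr0 // => i ij.
by rewrite mxE (negPf ij) andbF.
Qed.

Let coord_fw j c i : coord (f c * w j) 0 i = B i j c.
Proof.
have -> : coord (f c * w j) = \row_i B i j c; last by rewrite mxE.
by apply: coord_unique; rewrite fwE; apply: eq_bigr => l _; rewrite mxE.
Qed.

Let finsupp_B i j : (finsupp (B i j) `<=` finsupp f)%fset.
Proof.
apply/fsubsetP => c; rewrite !mem_finsupp -coord_fw; apply: contraNN => /eqP->.
by rewrite mul0r coord0 mxE.
Qed.

Let mon x c : laurent d A := lconst d x * lmonom c.

Section Relation.
Context (psi : laurent d A -> C) (U : G -> 'I_r -> C).
Hypotheses (psiD : {morph psi : x y / x + y >-> x * y})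
  (psi_neq0 : forall x, psi x != 0) (U_neq0 : forall a i, U a i != 0)
  (psiU : forall x c, psi (mon x c) = \prod_i U (red m c) i ^ coord x 0 i).

(* A homomorphism [psi] depending only on exponents modulo [n] is given by its values
   [U a i] on [w i * t^a]; it kills the multiples of [f] exactly when [U] is killed by
   the columns of the circulant matrix. *)
Lemma mulchar_circulant j b : psi (f * mon (w j) b) =
  \prod_(a : G) \prod_i U a i ^ circulant_block B a (red m b) i j.
Proof.
rewrite {1}[f]laurent_expand mulr_suml (mulchar_sum psiD psi_neq0).
transitivity (\prod_(c <- finsupp f) \prod_i U (red m c + red m b) i ^ B i j c).
  apply: eq_bigr => c _; rewrite /mon mulrACA -rmorphM -lmonomD.
  by rewrite [LHS]psiU redD; apply: eq_bigr => i _; rewrite coord_fw.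
rewrite exchange_big [RHS]exchange_big; apply: eq_bigr => i _ /=.
rewrite -(big_fset_incl _ (finsupp_B i j)) => [|c _ cB]; last first.
  by rewrite (fsfun_dflt cB) expr0z.
under [RHS]eq_bigr => a _.
  rewrite mxE (big_morph (exprz (U a i)) (op1 := *%R) (id1 := 1)) ?expr0z //; last first.
    by move=> x y; rewrite expfzDr.
  rewrite big_mkcond; over.
rewrite exchange_big; apply: eq_bigr => c _ /=.
rewrite (bigD1 (red m c + red m b)) //= eqxx big1 ?mulr1 // => a.
by rewrite eq_sym => /negPf->.
Qed.

End Relation.

(** The flat indices of the block matrix correspond to pairs of a class in [G] and a basis index. *)
Let N := (\sum_(k < #|{: G}|) r)%N.
Let pos (p : {k : 'I_#|{: G}| & 'I_r}) : G := enum_val (tag p).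
Let idx (p : {k : 'I_#|{: G}| & 'I_r}) : 'I_r := tagged p.
Let sig (s : 'I_N) : {k : 'I_#|{: G}| & 'I_r} := tagnat.sig s.
Let rank (a : G) (i : 'I_r) : 'I_N :=
  tagnat.rank (existT (fun=> 'I_r) (enum_rank a) i).

Let rankK a i : (pos (sig (rank a i)) = a) * (idx (sig (rank a i)) = i).
Proof. by rewrite /sig /rank tagnat.rankK /pos enum_rankK. Qed.

Let sigK s : rank (pos (sig s)) (idx (sig s)) = s.
Proof. by rewrite /rank /pos enum_valK -[RHS]tagnat.sigK /idx /sig; case: tagnat.sig. Qed.

Let prod_blocks (F : G -> 'I_r -> C) :
  \prod_(s < N) F (pos (sig s)) (idx (sig s)) = \prod_(a : G) \prod_i F a i.
Proof.
rewrite [RHS](big_enum_val (A := {: G})) sig_big_dep.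
by rewrite (reindex _ tagnat.sig_bij_on).
Qed.

Let circulantE s t : circulant m B s t =
  circulant_block B (pos (sig s)) (pos (sig t)) (idx (sig s)) (idx (sig t)).
Proof. by rewrite mxE. Qed.

Let row_of (U : G -> 'I_r -> C) : 'rV[C]_N := \row_s U (pos (sig s)) (idx (sig s)).

Lemma mpow_row_of U t : mpow (row_of U) (circulant m B) 0 t =
  \prod_(a : G) \prod_i U a i ^ circulant_block B a (pos (sig t)) i (idx (sig t)).
Proof.
by rewrite mxE -prod_blocks; apply: eq_bigr => s _; rewrite mxE circulantE.
Qed.

Local Notation pi := (\pi_(Quotient.quot (principal_ideal f)))%qT.

Let pi_eq g h : (exists k, g - h = f * k) -> pi g = pi h.
Proof. by move=> gh; apply/eqP; rewrite -Quotient.idealrBE; apply/asboolP. Qed.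

Let mon_expand g : g = \sum_(c <- finsupp g) mon (g c) c.
Proof. exact: laurent_expand. Qed.

Section Forward.
Context (chi : dual_system R f).
Hypothesis chi_fixed : fixed_points (dual_shift (f := f)) n chi.

Let psi g : C := chi (pi g).

Let psiD : {morph psi : x y / x + y >-> x * y}.
Proof. by move=> g h; rewrite /psi raddfD char_add. Qed.

Let psi_neq0 g : psi g != 0.
Proof. by rewrite -normr_eq0 char_circle oner_eq0. Qed.

(** [mon x c] is the shift of [mon x c'] by [c - c'], an element of [(nZ)^d], and [chi] is fixed. *)
Let psi_red x c c' : red m c = red m c' -> psi (mon x c) = psi (mon x c').
Proof.
move=> cc'; have d0 : red m (c - c') = 0.
  by apply: (addIr (red m c')); rewrite -redD subrK add0r.
have dP i : (n %| (c - c') ord0 i)%Z by move/eqP: d0; rewrite red_eq0 => /forallP.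
have := congr1 (fun y : dual_system R f => y (pi (mon x c'))) (chi_fixed dP).
by rewrite /= shift_pi /mon mulrCA -lmonomD subrK.
Qed.

Definition dual_row : G -> 'I_r -> C := fun a i => psi (mon (w i) (zlift a)).

Lemma dual_rowE x c : psi (mon x c) = \prod_i dual_row (red m c) i ^ coord x 0 i.
Proof.
rewrite (psi_red x (esym (zliftK (red m c)))) {1}[x]coordE /mon raddf_sum mulr_suml.
rewrite (mulchar_sum psiD psi_neq0); apply: eq_bigr => i _.
by rewrite raddfMz mulrzAl (mulcharMz psiD psi_neq0).
Qed.

(** [chi] is trivial on each [f * mon (w j) b], and by [mulchar_circulant] these values are the
    coordinates of the monomial map. *)
Lemma dual_row_ker : mpow_ker (circulant m B) (row_of dual_row).
Proof.
split=> [s|]; first by rewrite mxE psi_neq0.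
apply/rowP => t; rewrite mpow_row_of [RHS]mxE.
have U0 a i : dual_row a i != 0 by exact: psi_neq0.
have := mulchar_circulant psiD psi_neq0 U0 dual_rowE (idx (sig t)) (zlift (pos (sig t))).
rewrite zliftK => <-; rewrite -(mulchar0 psiD psi_neq0) /psi.
by congr (chi _); apply: pi_eq; rewrite subr0; eexists.
Qed.

End Forward.

(** By additivity and [dual_rowE] a fixed character is determined by its values on the
    [w i * t^a]. *)
Lemma dual_row_inj : {in [set chi | fixed_points (dual_shift (R := R) (f := f)) n chi] &,
  injective (fun chi => row_of (dual_row chi))}.
Proof.
move=> x y; rewrite !inE => xf yf xy.
have U a i : dual_row x a i = dual_row y a i.
  by have /rowP/(_ (rank a i)) := xy; rewrite !mxE !rankK.
apply: character_ext; apply/funext; elim/quotW => g.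
rewrite [g]mon_expand raddf_sum.
have neq0 (z : dual_system R f) g' : z g' != 0.
  by rewrite -normr_eq0 char_circle oner_eq0.
rewrite (mulchar_sum (char_add x) (neq0 x)) (mulchar_sum (char_add y) (neq0 y)).
apply: eq_bigr => c _; rewrite [LHS](dual_rowE xf) [RHS](dual_rowE yf).
by apply: eq_bigr => i _; rewrite U.
Qed.

Section Backward.
Context (U : G -> 'I_r -> C).
Hypotheses (U1 : forall a i, `|U a i| = 1)
  (Uker : mpow (row_of U) (circulant m B) = const_mx 1).

Let U_neq0 a i : U a i != 0. Proof. by rewrite -normr_eq0 U1 oner_eq0. Qed.

(** The value on [mon x c] that [dual_rowE] forces. *)
Let monval (x : A) c : C := \prod_i U (red m c) i ^ coord x 0 i.

Let psi (g : laurent d A) : C := \prod_(c <- finsupp g) monval (g c) c.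

Let monval0 c : monval 0 c = 1.
Proof. by rewrite /monval coord0 big1 // => i _; rewrite mxE expr0z. Qed.

Let psi_widen g (S : {fset 'rV[int]_d}) : (finsupp g `<=` S)%fset ->
  psi g = \prod_(c <- S) monval (g c) c.
Proof.
by move=> gS; apply: big_fset_incl => // c _ /fsfun_dflt ->; rewrite monval0.
Qed.

Let psiD : {morph psi : x y / x + y >-> x * y}.
Proof.
move=> g h; pose S := (finsupp g `|` finsupp h)%fset.
rewrite (@psi_widen g S) ?fsubsetUl // (@psi_widen h S) ?fsubsetUr //.
rewrite (@psi_widen (g + h) S); last first.
  apply/fsubsetP => a; rewrite in_fsetU !mem_finsupp laurentDE.
  by apply: contraNT; rewrite negb_or !negbK => /andP[/eqP-> /eqP->]; rewrite addr0.
rewrite -big_split; apply: eq_bigr => c _; rewrite laurentDE /monval -big_split.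
by apply: eq_bigr => i _; rewrite coordD mxE expfzDr.
Qed.

Let psi_norm g : `|psi g| = 1.
Proof.
rewrite /psi normr_prod big1 // => c _; rewrite normr_prod big1 // => i _.
by case: (coord _ 0 i) => k; rewrite ?NegzE -?exprnN -?exprnP ?normfV normrX U1 expr1n ?invr1.
Qed.

Let psi_neq0 g : psi g != 0. Proof. by rewrite -normr_eq0 psi_norm oner_eq0. Qed.

Let psi_mon x c : psi (mon x c) = \prod_i U (red m c) i ^ coord x 0 i.
Proof.
rewrite (@psi_widen _ [fset c]%fset).
  by rewrite big_seq_fset1 /mon lconstM lmonomE eqxx mulr1.
apply/fsubsetP => e; rewrite mem_finsupp lconstM lmonomE inE.
by case: (e =P c) => // _; rewrite mulr0 eqxx.
Qed.

(** The multiples of [f] are additively generated by the [f * mon (w i) c], where the kernel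
    condition gives the value [1]. *)
Let psi_ideal g : psi (f * g) = 1.
Proof.
rewrite [g]mon_expand mulr_sumr (mulchar_sum psiD psi_neq0) big1 // => c _.
rewrite [g c]coordE /mon raddf_sum mulr_suml mulr_sumr.
rewrite (mulchar_sum psiD psi_neq0) big1 // => i _.
rewrite raddfMz mulrzAl mulrzAr (mulcharMz psiD psi_neq0).
rewrite (mulchar_circulant psiD psi_neq0 U_neq0 psi_mon).
have /rowP/(_ (rank (red m c) i)) := Uker; rewrite mpow_row_of mxE !rankK => ->.
by rewrite exp1rz.
Qed.

(** [psi] is constant on cosets of the ideal, so its values on chosen representatives define a
    character of the quotient. *)
Let psi_repr g : psi (repr (pi g)) = psi g.
Proof.
have /eqP : pi (repr (pi g)) = pi g by rewrite reprK.
rewrite -Quotient.idealrBE => /asboolP[k kE].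
by rewrite -[repr _](subrK g) psiD kE psi_ideal mul1r.
Qed.

Let chi_add : {morph (fun x : laurent_quot f => psi (repr x)) : x y / x + y >-> x * y}.
Proof.
elim/quotW=> g; elim/quotW=> h.
by rewrite -[in LHS]raddfD !psi_repr psiD.
Qed.

Let chi : dual_system R f := Character chi_add (fun x => psi_norm (repr x)).

Lemma row_of_dual :
  exists2 x, fixed_points (dual_shift (R := R) (f := f)) n x & row_of (dual_row x) = row_of U.
Proof.
exists chi.
  move=> delta dP; apply: character_ext; apply/funext; elim/quotW => g /=.
  rewrite shift_pi !psi_repr [g]mon_expand mulr_sumr !(mulchar_sum psiD psi_neq0).
  apply: eq_bigr => c _; rewrite /mon mulrCA -lmonomD !psi_mon redD.
  have -> : red m delta = 0 by apply/eqP; rewrite red_eq0; apply/forallP.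
  by rewrite add0r.
apply/rowP => s; rewrite !mxE /dual_row /= psi_repr psi_mon coord_w zliftK.
rewrite (bigD1 (idx (sig s))) //= mxE !eqxx expr1z big1 ?mulr1 // => i ij.
by rewrite mxE (negPf ij) andbF expr0z.
Qed.

End Backward.

Theorem card_fixed_points : \det (circulant m B) != 0 ->
  (fixed_points (dual_shift (R := R) (f := f)) n #= `I_(`|\det (circulant m B)|%N))%card.
Proof.
move=> C0; apply: card_eq_trans (card_mpow_ker _ C0).
have := inj_card_eq dual_row_inj; set img := _ @` _.
suff -> : img = mpow_ker (circulant m B).
  by move=> E; rewrite card_eq_sym; exact: E.
apply/seteqP; split=> [_ [x xf <-]|u [u0 uC]]; first exact: dual_row_ker.
(* [mpow_ker] allows all nonzero complex coordinates, characters only those on the circle. The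
   adjugate turns the equations into [u_s ^ \det = 1], which forces modulus one. *)
have u1 s : `|u 0 s| = 1.
  have : mpow u (circulant m B *m \adj (circulant m B)) = const_mx 1.
    by rewrite -mpowM // uC mpow_const1.
  rewrite mul_mx_adj => /rowP/(_ s); rewrite !mxE (bigD1 s) //= [X in _ * X]big1 => [|i si].
    rewrite mulr1 mxE eqxx mulr1n => us.
    have : `|u 0 s| ^+ `|\det (circulant m B)| = 1.
      move: us; case: (\det _) => k; rewrite ?NegzE -?exprnN -?exprnP.
        by move/(congr1 Num.norm); rewrite normrX normr1.
      by move/(congr1 Num.norm); rewrite normfV normrX normr1 => /eqP; rewrite invr_eq1 => /eqP.
    by move/eqP; rewrite pexpr_eq1 ?absz_gt0 // => /eqP.
  by rewrite mxE (negPf si) mulr0n expr0z.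
pose U a i := u 0 (rank a i).
have uE : row_of U = u by apply/rowP => s; rewrite mxE /U sigK.
have U1 a i : `|U a i| = 1 by exact: u1.
have UC : mpow (row_of U) (circulant m B) = const_mx 1 by rewrite uE.
have [x xf xU] := row_of_dual U1 UC.
by exists x; [exact: xf | rewrite xU uE].
Qed.

End FixedPoints.

(** * The p-adic Mahler measure *)

Section PadicNorm.
Context (R : realType) (p : nat) (Cp : fieldType) (nrm : Cp -> R).
Hypotheses (p_prime : prime p) (Hp : is_padic_complex p nrm).

Let ge0 x : 0 <= nrm x. Proof. exact: nrm_ge0 Hp x. Qed.

Lemma nrm0 : nrm 0 = 0. Proof. exact/(nrm_eq0 Hp). Qed.

Lemma nrm_neq0 x : (nrm x != 0) = (x != 0).
Proof.
by congr (~~ _); apply/eqP/eqP => [/(nrm_eq0 Hp)|->] //; exact: nrm0.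
Qed.

Lemma nrm_gt0 x : (0 < nrm x) = (x != 0).
Proof. by rewrite lt0r nrm_neq0 ge0 andbT. Qed.

Lemma nrm1 : nrm 1 = 1.
Proof.
apply: (mulfI (x := nrm 1)); first by rewrite nrm_neq0 oner_eq0.
by rewrite -(nrmM Hp) !mulr1.
Qed.

Lemma nrmX x k : nrm (x ^+ k) = nrm x ^+ k.
Proof. by elim: k => [|k IHk]; rewrite ?nrm1 // !exprS (nrmM Hp) IHk. Qed.

Lemma nrmN x : nrm (- x) = nrm x.
Proof.
have : nrm (-1) ^+ 2 = 1 by rewrite -nrmX sqrrN expr1n nrm1.
move=> /eqP; rewrite sqrf_eq1 => /orP[|] /eqP N1.
  by rewrite -mulN1r (nrmM Hp) N1 mul1r.
by have := ge0 (-1); rewrite N1 ler0N1.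
Qed.

Lemma nrmV x : nrm x^-1 = (nrm x)^-1.
Proof.
have [->|x0] := eqVneq x 0; first by rewrite invr0 nrm0 invr0.
by apply: (mulfI (x := nrm x)); rewrite ?nrm_neq0 // -(nrmM Hp) !divff ?nrm1 ?nrm_neq0.
Qed.

Lemma nrm_root_of_unity x n : (0 < n)%N -> x ^+ n = 1 -> nrm x = 1.
Proof.
move=> n0 /(congr1 nrm); rewrite nrmX nrm1 => /eqP.
by rewrite pexpr_eq1 ?ge0 // => /eqP.
Qed.

Lemma nrmD_le x y e : nrm x <= e -> nrm y <= e -> nrm (x + y) <= e.
Proof. by move=> xe ye; apply: le_trans (nrm_ultra Hp x y) _; rewrite ge_max xe. Qed.

Lemma nrmB_le x y e : nrm x <= e -> nrm y <= e -> nrm (x - y) <= e.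
Proof. by move=> xe ye; apply: nrmD_le; rewrite ?nrmN. Qed.

Lemma nrmD_lt x y e : nrm x < e -> nrm y < e -> nrm (x + y) < e.
Proof. by move=> xe ye; apply: le_lt_trans (nrm_ultra Hp x y) _; rewrite gt_max xe. Qed.

Lemma nrmD_eq x y : nrm y < nrm x -> nrm (x + y) = nrm x.
Proof.
move=> yx; apply/le_anti; rewrite nrmD_le // ?(ltW yx) //= leNgt.
apply/negP => xyx; have : nrm (x + y - y) < nrm x by apply: nrmD_lt; rewrite ?nrmN.
by rewrite addrK ltxx.
Qed.

Lemma nrm_sum_le (I : Type) (s : seq I) (P : pred I) (F : I -> Cp) e : 0 <= e ->
  (forall i, P i -> nrm (F i) <= e) -> nrm (\sum_(i <- s | P i) F i) <= e.
Proof.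
move=> e0 Fe; elim/big_ind: _ => //; first by rewrite nrm0.
by move=> x y; exact: nrmD_le.
Qed.

Lemma nrm_nat_le1 k : nrm k%:R <= 1.
Proof.
by elim: k => [|k IHk]; rewrite ?nrm0 // -natr1; apply: nrmD_le; rewrite ?nrm1.
Qed.

(** If [k] had absolute value below one, a Bezout relation between [k] and [p] would give the same
    for [1]. *)
Lemma nrm_coprime k : coprime k p -> nrm k%:R = 1.
Proof.
move=> kp; have p_gt0 := prime_gt0 p_prime.
apply/le_anti; rewrite nrm_nat_le1 /=.
have /(coprimeP _ p_gt0)[[u v] /= uv] : coprime p k by rewrite coprime_sym.
have {uv} uv : (u * p = 1 + v * k)%N by rewrite -uv subnK // ltnW // -subn_gt0 uv.
have E : 1 = u%:R * p%:R - v%:R * k%:R :> Cp.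
  by rewrite -!natrM uv natrD addrK.
rewrite leNgt; apply/negP => k1; have : nrm 1 < 1; last by rewrite nrm1 ltxx.
rewrite E; apply: nrmD_lt; rewrite ?nrmN (nrmM Hp).
  rewrite (nrm_p Hp); apply: le_lt_trans (_ : 1 * p%:R^-1 < 1).
    by rewrite ler_wpM2r ?invr_ge0 ?nrm_nat_le1.
  by rewrite mul1r invf_lt1 ?ltr1n ?ltr0n // prime_gt1.
by apply: le_lt_trans k1; rewrite -[leRHS]mul1r ler_wpM2r ?ge0 ?nrm_nat_le1.
Qed.

(** The left side is the exact power of [p] dividing [k]. *)
Lemma nrm_natV k : (0 < k)%N -> nrm k%:R^-1 <= k%:R.
Proof.
move=> k0; have [j pj kE] := pfactor_coprime p_prime k0.
have j0 : (0 < j)%N by move: k0; rewrite kE muln_gt0 => /andP[].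
rewrite nrmV kE natrM (nrmM Hp) nrm_coprime 1?coprime_sym // mul1r.
rewrite !natrX nrmX (nrm_p Hp) exprVn invrK -natrX ler_nat -kE.
by rewrite {2}kE leq_pmull.
Qed.

Lemma padic_natr_eq0 k : (k%:R == 0 :> Cp) = (k == 0)%N.
Proof.
case: k => [|k]; first by rewrite mulr0n !eqxx.
have [j pj kE] := pfactor_coprime p_prime (ltn0Sn k).
transitivity false => //; apply/negbTE; rewrite kE -nrm_gt0 natrM (nrmM Hp) nrm_coprime 1?coprime_sym // mul1r.
by rewrite natrX nrmX (nrm_p Hp) exprn_gt0 // invr_gt0 ltr0n prime_gt0.
Qed.

Lemma padic_intr_eq0 z : (z%:~R == 0 :> Cp) = (z == 0).
Proof.
case: z => k; first by rewrite -pmulrn padic_natr_eq0.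
by rewrite NegzE mulrNz oppr_eq0 -pmulrn padic_natr_eq0 oppr_eq0.
Qed.

(* [ratr] is known to be a morphism only into a [numFieldType]; only characteristic
   zero is needed. *)
Lemma padic_ratr_frac (a b : int) : b != 0 ->
  ratr (a%:~R / b%:~R) = a%:~R / b%:~R :> Cp.
Proof.
move=> b0; case: (divqP a b) b0 => // k x k0 b0; rewrite /ratr.
have k0' : k%:~R != 0 :> Cp by rewrite padic_intr_eq0.
by rewrite !rmorphM /= -mulf_div divff // mul1r.
Qed.

Lemma padic_ratr_zmod : zmod_morphism (ratr : rat -> Cp).
Proof.
move=> x y; rewrite -[x]divq_num_den -[y]divq_num_den.
have [dx dy] := (denq_neq0 x, denq_neq0 y).
have E (F : fieldType) : (denq x)%:~R != 0 :> F -> (denq y)%:~R != 0 :> F ->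
    (numq x)%:~R / (denq x)%:~R - (numq y)%:~R / (denq y)%:~R =
    (numq x * denq y - numq y * denq x)%:~R / (denq x * denq y)%:~R :> F.
  by move=> dx0 dy0; rewrite -mulNr addf_div // rmorphB !rmorphM mulNr.
rewrite E ?intr_eq0 // !padic_ratr_frac ?mulf_neq0 //.
by rewrite -E ?padic_intr_eq0.
Qed.

Lemma padic_ratr_monoid : monoid_morphism (ratr : rat -> Cp).
Proof.
split=> [|x y]; first by have := @padic_ratr_frac 1 1 isT; rewrite !divr1.
rewrite -[x]divq_num_den -[y]divq_num_den mulf_div -!rmorphM.
by rewrite !padic_ratr_frac ?mulf_neq0 ?denq_neq0 // !rmorphM mulf_div.
Qed.

Definition padic_rat : {rmorphism rat -> Cp} := HB.pack (ratr : rat -> Cp)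
  (GRing.isZmodMorphism.Build _ _ _ padic_ratr_zmod)
  (GRing.isMonoidMorphism.Build _ _ _ padic_ratr_monoid).

Lemma integral_padic_algebraic x : integralOver padic_rat x -> padic_algebraic nrm x.
Proof.
case=> P P_mon Px; exists (map_poly padic_rat P); split=> //.
  by rewrite map_poly_eq0 monic_neq0.
by move=> i e e0; exists (P`_i); rewrite coef_map subrr nrm0.
Qed.

(* [Cp] is not assumed algebraically closed, only the algebraic elements are; the
   elements algebraic over [Q] suffice here since they stay so under division by
   [X - x]. *)
Lemma integral_poly_splits (P : {poly Cp}) : P != 0 ->
  (forall i, integralOver padic_rat P`_i) ->
  exists rs, P = lead_coef P *: \prod_(a <- rs) ('X - a%:P).
Proof.
move sP: (size P) => n; elim: n P sP => [|n IHn] P sP P0 PI.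
  by move/eqP: sP P0; rewrite size_poly_eq0 => ->.
case: n => [|n] in IHn sP.
  exists [::]; rewrite big_nil alg_polyC.
  by rewrite {1}(size1_polyC (eq_leq sP)) lead_coefE sP.
have [|x _ Px] := padic_algebraic_closed Hp (P := P) _
  (fun i => integral_padic_algebraic (PI i)); first by rewrite sP.
have xI : integralOver padic_rat x.
  by apply: integral_root Px _ => //; apply/integral_poly.
have /factor_theorem[Q PE] := Px.
have Q0 : Q != 0 by apply: contraNneq P0 => Q0; rewrite PE Q0 mul0r.
have sQ : size Q = n.+1.
  by have := sP; rewrite PE size_Mmonic ?monicXsubC // size_XsubC addn2 => -[].
(* Descending recursion on the coefficients, from the zero ones beyond the size of [Q]. *)
have QI i : integralOver padic_rat Q`_i.
  have : (size Q <= i + n.+1)%N by rewrite sQ leq_addl.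
  elim: (n.+1) i => [|k IHk] i; rewrite ?addn0 => sQi.
    by rewrite nth_default //; exact: mxpoly.integral0.
  have -> : Q`_i = P`_i.+1 + x * Q`_i.+1.
    by rewrite PE mulrBr coefB coefMX coefMC /= mulrC subrK.
  apply: integral_add (PI _) _; apply: integral_mul xI _.
  by apply: IHk; rewrite addSnnS.
have [rs rsE] := IHn _ sQ Q0 QI; exists (x :: rs).
rewrite big_cons {1}PE {1}rsE PE lead_coef_Mmonic ?monicXsubC //.
by rewrite -scalerAl mulrC.
Qed.

Lemma int_poly_splits (P : {poly int}) : P != 0 ->
  exists rs, map_poly intr P = (lead_coef P)%:~R *: \prod_(a <- rs) ('X - a%:P) :> {poly Cp}.
Proof.
move=> P0; have inj : injective (intr : int -> Cp).
  by move=> x y /eqP; rewrite -subr_eq0 -rmorphB padic_intr_eq0 subr_eq0 => /eqP.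
have [||rs rsE] := @integral_poly_splits (map_poly intr P).
- by rewrite map_poly_eq0_id0 // padic_intr_eq0 lead_coef_eq0.
- move=> i; rewrite coef_map /= -(rmorph_int padic_rat); exact: integral_id.
exists rs; rewrite {1}rsE lead_coef_map_inj //.
Qed.

Lemma padic_prim_root n : (0 < n)%N -> exists w : Cp, n.-primitive_root w.
Proof.
move=> n0; have [|rs] := @int_poly_splits ('X^n - 1).
  by rewrite monic_neq0 // monicXnsubC.
rewrite rmorphB /= map_polyXn rmorph1 (monicP (monicXnsubC _ n0)) scale1r.
by apply: prim_root_of_split; rewrite padic_natr_eq0 -lt0n.
Qed.

(* Multiplying by [X - a] shifts the dominant coefficient by one if [|a| < 1] and
   leaves it in place if [|a| > 1]. *)
Lemma dominant_coef (c : Cp) (rs : seq Cp) : c != 0 -> (forall a, a \in rs -> nrm a != 1) ->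
  exists k, forall j, j != k ->
    nrm (c *: \prod_(a <- rs) ('X - a%:P))`_j < nrm (c *: \prod_(a <- rs) ('X - a%:P))`_k.
Proof.
move=> c0; elim: rs => [|a rs IHrs] rs1.
  exists 0%N => -[|j] // _; rewrite big_nil !coefZ !coef1 /= mulr0 mulr1 nrm0.
  by rewrite nrm_gt0.
have [|k kP] := IHrs; first by move=> b brs; apply: rs1; rewrite inE brs orbT.
rewrite big_cons mulrC scalerAl; set P := c *: _ in kP *.
have M0 : 0 < nrm P`_k by apply: le_lt_trans (ge0 _) (kP k.+1 _); rewrite gtn_eqF.
have MP j : nrm P`_j <= nrm P`_k by have [->//|/kP/ltW] := eqVneq j k.
have coefE j : (P * ('X - a%:P))`_j = (if j is i.+1 then P`_i else 0) - a * P`_j.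
  by rewrite mulrBr coefB coefMX coefMC [a * _]mulrC; case: j.
have := rs1 a (mem_head _ _); rewrite neq_lt => /orP[a1|a1].
  have small j : nrm (a * P`_j) < nrm P`_k.
    rewrite (nrmM Hp); apply: le_lt_trans (_ : nrm a * nrm P`_k < _).
      by rewrite ler_wpM2l.
    by rewrite gtr_pMl.
  exists k.+1 => -[|j]; rewrite !coefE => jk; rewrite [ltRHS]nrmD_eq ?nrmN //.
    by rewrite sub0r nrmN.
  by apply: nrmD_lt; rewrite ?nrmN // kP.
have big : nrm P`_k < nrm (a * P`_k) by rewrite (nrmM Hp) ltr_pMl.
have prev j : nrm (if j is i.+1 then P`_i else 0) <= nrm P`_k.
  by case: j => //; rewrite nrm0 ltW.
exists k => j jk; rewrite !coefE ![_ - a * _]addrC.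
rewrite [ltRHS]nrmD_eq ?nrmN ?(le_lt_trans (prev _)) //.
apply: nrmD_lt; rewrite ?nrmN ?(le_lt_trans (prev _)) //.
by rewrite !(nrmM Hp) ltr_pM2l ?kP // (lt_trans ltr01).
Qed.

End PadicNorm.

(* The substitution [t_i = s^(M^i)] separates finitely many exponents. *)
Lemma kronecker_injective (d : nat) (S : {fset 'rV[int]_d}) :
  exists M : nat, {in S &, injective (fun a : 'rV[int]_d => \sum_(i < d) a 0 i * M%:Z ^+ i)}.
Proof.
pose q (a : 'rV[int]_d) : {poly int} := rVpoly a.
pose Q := \prod_(a <- S) \prod_(b <- S | a != b) q (a - b).
have Q0 : Q != 0.
  rewrite prodf_seq_neq0; apply/allP => a _ /=.
  rewrite prodf_seq_neq0; apply/allP => b _; apply/implyP => ab.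
  apply: contraNneq ab => q0.
  by rewrite -subr_eq0 -[a - b]rVpolyK -/(q _) q0 raddf0.
(* Any [M] that is not a root of [Q] separates the exponents, and [size Q] distinct integers cannot
   all be roots. *)
have [M QM] : exists M : nat, Q.[M%:Z] != 0.
  apply/not_existsP => H; pose rs := [seq k%:Z | k <- iota 0 (size Q)].
  have : (size rs < size Q)%N.
    apply: max_poly_roots Q0 _ _.
      by apply/allP => _ /mapP[k _ ->]; apply/rootP/eqP; move/negP: (H k); rewrite negbK.
    by rewrite map_inj_uniq ?iota_uniq // => x y [].
  by rewrite size_map size_iota ltnn.
exists M => a b aS bS ab; apply/eqP; apply: contraTT isT => nab.
case/negP: QM; rewrite horner_prod prodf_seq_eq0; apply/hasP; exists a => //=.
rewrite horner_prod prodf_seq_eq0; apply/hasP; exists b => //=.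
rewrite nab /= /q (horner_coef_wide _ (size_poly _ _)).
under eq_bigr => i _ do rewrite coef_rVpoly_ord !mxE mulrBl.
by rewrite sumrB subr_eq0; apply/eqP.
Qed.

(** * The dominant coefficient of a polynomial without zeros on the torus *)

Section Dominant.
Context (R : realType) (p : nat) (Cp : fieldType) (nrm : Cp -> R).
Hypotheses (p_prime : prime p) (Hp : is_padic_complex p nrm).
Context (d : nat) (g : laurent d int).
Hypothesis g_torus : forall z : 'rV[Cp]_d, (forall i, nrm (z 0 i) = 1) ->
  leval (lmap intr g) z != 0.

Lemma dominant_monomial : exists2 a0, g a0 != 0 &
  forall a, a != a0 -> nrm (g a)%:~R < nrm (g a0)%:~R.
Proof.
have [M M_inj] := kronecker_injective (finsupp g).
pose phi (a : 'rV[int]_d) : int := \sum_(i < d) a 0 i * M%:Z ^+ i.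
(* The shift by [N0] makes all exponents nonnegative, so that [P] is a polynomial with the nonzero
   coefficients of [g]. *)
pose N0 : nat := (\sum_(a <- finsupp g) absz (phi a))%N.
pose e a : nat := absz (phi a + N0%:Z).
have eE a : a \in finsupp g -> (e a)%:Z = phi a + N0%:Z.
  move=> ag; rewrite /e abszE ger0_norm // -lerBlDl sub0r.
  apply: le_trans (ler_norm _) _; rewrite normrN -abszE lez_nat /N0.
  by rewrite (big_rem a) //= leq_addr.
have e_inj : {in finsupp g &, injective e}.
  by move=> a b ag bg /(congr1 Posz); rewrite !eE // => /addIr; exact: M_inj.
pose P : {poly int} := \sum_(a <- finsupp g) g a *: 'X^(e a).
have P_coef k : P`_k = \sum_(a <- finsupp g) g a * (k == e a)%:R.
  by rewrite coef_sum; apply: eq_bigr => a _; rewrite coefZ coefXn.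
have P_e a : a \in finsupp g -> P`_(e a) = g a.
  move=> ag; rewrite P_coef (bigD1_seq a) ?fset_uniq //= eqxx mulr1.
  rewrite big_seq_cond big1 ?addr0 // => b /andP[bg ba].
  by rewrite (inj_in_eq e_inj) // eq_sym (negPf ba) mulr0.
have g0 : exists a, a \in finsupp g.
  apply/not_existsP => H; have gE : g = 0.
    by apply/fsfunP => a; rewrite laurent0E; apply/fsfun_dflt/negP/H.
  have := g_torus (z := const_mx 1); rewrite gE raddf0 levalE raddf0 eqxx.
  have z1 (i : 'I_d) : nrm ((const_mx 1 : 'rV[Cp]_d) 0 i) = 1 by rewrite mxE (nrm1 Hp).
  by move/(_ z1).
have P0 : P != 0.
  have [a ag] := g0; apply/eqP => P0; have := P_e a ag.
  by rewrite P0 coef0 => ga; move: ag; rewrite mem_finsupp -ga eqxx.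
have [rs rsE] := int_poly_splits p_prime Hp P0.
have lead0 : (lead_coef P)%:~R != 0 :> Cp.
  by rewrite (padic_intr_eq0 p_prime Hp) lead_coef_eq0.
have rs1 x : x \in rs -> nrm x != 1.
  move=> xrs; have Px : (map_poly intr P).[x] = 0.
    by apply/rootP; rewrite rsE rootZ // root_prod_XsubC.
  apply/eqP => x1; have x0 : x != 0 by rewrite -(nrm_neq0 Hp) x1 oner_eq0.
  have nrmz z : nrm (x ^ z) = 1.
    by case: z => k; rewrite ?NegzE -?exprnN -?exprnP ?(nrmV Hp) (nrmX Hp) x1 expr1n ?invr1.
  (* A root [x] of [P] of absolute value one would yield a zero of [g] at this point of the
     torus. *)
  pose z : 'rV[Cp]_d := \row_i x ^ (M%:Z ^+ i).
  have /negP := g_torus (z := z) (fun i => ltac:(by rewrite mxE nrmz)); apply.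
  have zE a : zpow z a = x ^ phi a.
    rewrite /zpow /phi (big_morph (exprz x) (op1 := *%R) (id1 := 1)) ?expr0z //.
      by apply: eq_bigr => i _; rewrite mxE exprz_exp mulrC.
    by move=> u v; rewrite expfzDr.
  rewrite leval_lmap; have xN0 : x ^ N0%:Z != 0 by rewrite expfz_neq0.
  apply/eqP/(mulIf xN0); rewrite mul0r -Px /P (raddf_sum (map_poly intr)) horner_sum /lev mulr_suml.
  rewrite [LHS]big_seq [RHS]big_seq; apply: eq_bigr => a ag.
  rewrite zE -mulrA -expfzDr // -eE // -exprnP.
  by rewrite /= map_polyZ /= map_polyXn hornerZ hornerXn.
have [k] := dominant_coef Hp lead0 rs1; rewrite -rsE => kP.
(* A strictly dominant coefficient is nonzero, so [k] comes from a monomial of [g]. *)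
have [[a0 a0g ka0]|nk] := pselect (exists2 a, a \in finsupp g & k = e a); last first.
  have Pk : P`_k = 0; last first.
    have := kP k.+1; rewrite gtn_eqF // !coef_map Pk => /(_ isT).
    by rewrite /= (nrm0 Hp) ltNge (nrm_ge0 Hp).
  rewrite P_coef big_seq big1 // => a ag; case: eqP => [ka|_]; last by rewrite mulr0.
  by case: nk; exists a.
exists a0 => [|a aa0]; first by rewrite -mem_finsupp.
have k0 : 0 < nrm (g a0)%:~R.
  rewrite (nrm_gt0 Hp) (padic_intr_eq0 p_prime Hp).
  by rewrite -mem_finsupp.
have [ag|/fsfun_dflt->] := boolP (a \in finsupp g); last by rewrite (nrm0 Hp).
have := kP (e a); rewrite ka0 (inj_in_eq e_inj) // !coef_map !P_e //.
by apply.
Qed.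

End Dominant.

(* With [s = sqrt rho], Bernoulli gives [s^-k >= k t], so [k rho^k <= 1/(k t^2)]. *)
Lemma natr_mul_expr_small (R : realType) (rho e : R) : 0 < rho -> rho < 1 -> 0 < e ->
  exists K : nat, forall k, (K <= k)%N -> k%:R * rho ^+ k <= e.
Proof.
move=> r0 r1 e0; pose s := Num.sqrt rho.
have s0 : 0 < s by rewrite sqrtr_gt0.
have s1 : s < 1 by rewrite -(sqrtr1 R) ltr_sqrt.
have sE : rho = s ^+ 2 by rewrite sqr_sqrtr // ltW.
pose t := s^-1 - 1; have t0 : 0 < t by rewrite subr_gt0 invf_gt1.
have bern k : 1 + k%:R * t <= s^-1 ^+ k.
  elim: k => [|k IHk]; first by rewrite mul0r addr0.
  rewrite exprS; apply: le_trans (_ : s^-1 * (1 + k%:R * t) <= _); last first.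
    by rewrite ler_wpM2l // invr_ge0 ltW.
  have -> : s^-1 = 1 + t by rewrite addrC subrK.
  rewrite -natr1 (_ : (1 + t) * _ = 1 + (k%:R + 1) * t + k%:R * t ^+ 2); last by ring.
  by rewrite lerDl mulr_ge0 ?exprn_ge0 ?(ltW t0).
pose K := Num.bound (e * t ^+ 2)^-1; exists K.+1 => k Kk.
have k0 : 0 < k%:R :> R by rewrite ltr0n (leq_trans _ Kk).
have kt : (k%:R * t) ^+ 2 * rho ^+ k <= 1.
  have : (k%:R * t) ^+ 2 <= (s^-1 ^+ k) ^+ 2.
    rewrite ler_sqr ?nnegrE ?mulr_ge0 ?exprn_ge0 ?invr_ge0 ?(ltW t0) ?(ltW s0) //.
    by apply: le_trans (bern k); rewrite lerDr.
  rewrite -exprM mulnC exprM exprVn -sE => H.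
  apply: le_trans (_ : rho^-1 ^+ k * rho ^+ k <= _).
    by rewrite ler_wpM2r // exprn_ge0 // ltW.
  by rewrite -exprMn mulVf ?expr1n // gt_eqF.
have bK : (e * t ^+ 2)^-1 < k%:R.
  apply: lt_le_trans (archi_boundP _) _; first by rewrite invr_ge0 mulr_ge0 ?exprn_ge0 ?ltW.
  by rewrite ler_nat ltnW.
have et0 : 0 < e * t ^+ 2 by rewrite mulr_gt0 // exprn_gt0.
have : 1 <= k%:R * (e * t ^+ 2).
  by rewrite -ler_pdivrMr // mul1r ltW.
move=> H; rewrite -(@ler_pM2l _ (k%:R * t ^+ 2)) ?mulr_gt0 ?exprn_gt0 //.
apply: le_trans (_ : 1 <= _).
  by apply: le_trans kt; rewrite le_eqVlt; apply/orP; left; apply/eqP; ring.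
by rewrite -mulrA [_ ^+ 2 * e]mulrC.
Qed.

(** * The logarithm and convergence of the torsion averages *)

Section PadicLog.
Context (R : realType) (p : nat) (Cp : fieldType) (nrm : Cp -> R) (logp : Cp -> Cp).
Hypotheses (p_prime : prime p) (Hp : is_padic_complex p nrm)
  (Hlog : is_padic_log p nrm logp).

Lemma logp1 : logp 1 = 0.
Proof.
by apply: (addIr (logp 1)); rewrite -(logpM Hlog) ?oner_eq0 // mulr1 add0r.
Qed.

Lemma logpX x k : x != 0 -> logp (x ^+ k) = k%:R * logp x.
Proof.
move=> x0; elim: k => [|k IHk]; first by rewrite mul0r logp1.
by rewrite exprS (logpM Hlog) ?expf_neq0 // IHk -natr1 mulrDl mul1r addrC.
Qed.

Lemma logp_root_of_unity x k : (0 < k)%N -> x ^+ k = 1 -> logp x = 0.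
Proof.
move=> k0 xk; have x0 : x != 0.
  by rewrite -(nrm_neq0 Hp) (nrm_root_of_unity Hp k0 xk) oner_eq0.
have /eqP := logpX k x0; rewrite xk logp1 eq_sym mulf_eq0.
by rewrite (padic_natr_eq0 p_prime Hp) gtn_eqF // => /eqP.
Qed.

Lemma logpN x : x != 0 -> logp (- x) = logp x.
Proof.
move=> x0; rewrite -mulN1r (logpM Hlog) ?oppr_eq0 ?oner_eq0 //.
by rewrite (@logp_root_of_unity (-1) 2) ?add0r // sqrrN expr1n.
Qed.

Lemma logp_prod (I : Type) (s : seq I) (P : pred I) (F : I -> Cp) :
  (forall i, P i -> F i != 0) ->
  logp (\prod_(i <- s | P i) F i) = \sum_(i <- s | P i) logp (F i).
Proof.
move=> F0; elim: s => [|i s IHs]; first by rewrite !big_nil logp1.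
rewrite !big_cons; case: ifP => // Pi; rewrite (logpM Hlog) ?F0 // ?IHs //.
by elim/big_rec: _ => [|j x Pj x0]; rewrite ?oner_eq0 // mulf_neq0 ?F0.
Qed.

(** A truncated logarithm series with [F k] in place of the powers, so that it serves both for the
    values of [h] and for the constant coefficients of its powers. *)
Definition log_sum (F : nat -> Cp) (K : nat) : Cp :=
  \sum_(1 <= k < K) (-1) ^+ k.+1 * F k / k%:R.

(** The term of index [k] is at most [k * rho ^ k], and an ultrametric sum is bounded by its largest
    term. *)
Lemma log_sum_tail (F : nat -> Cp) (rho e : R) K m n :
  (forall k, nrm (F k) <= rho ^+ k) -> 0 <= e ->
  (forall k, (K <= k)%N -> k%:R * rho ^+ k <= e) -> (0 < K)%N ->
  (K <= m)%N -> (K <= n)%N -> nrm (log_sum F m - log_sum F n) <= e.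
Proof.
move=> Frho e0 Ke K0 Km Kn; rewrite /log_sum (big_cat_nat K0 Km) (big_cat_nat K0 Kn) /=.
rewrite opprD addrACA subrr add0r.
have tail q : nrm (\sum_(K <= k < q) (-1) ^+ k.+1 * F k / k%:R) <= e.
  rewrite big_nat; apply: (nrm_sum_le Hp) => // k /andP[Kk _].
  rewrite !(nrmM Hp) (nrmX Hp) (nrmN Hp) (nrm1 Hp) expr1n mul1r.
  apply: le_trans (Ke _ Kk); rewrite mulrC ler_pM ?(nrm_ge0 Hp) //.
  by apply: nrm_natV Hp _ _ => //; exact: leq_trans Kk.
exact: (nrmB_le Hp).
Qed.

(** The condition on [K] does not involve [x], so the truncation is uniform; the index [N] depending
    on [x] enters only through an intermediate partial sum. *)
Lemma log_sum_logp (rho e : R) K x : nrm x <= rho -> rho < 1 -> 0 < e ->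
  (forall k, (K <= k)%N -> k%:R * rho ^+ k <= e) -> (0 < K)%N ->
  nrm (log_sum (fun k => x ^+ k) K - logp (1 + x)) <= e.
Proof.
move=> xr r1 e0 Ke K0; have := logp_series Hlog (le_lt_trans xr r1).
move=> /cvgr0Pnorm_lt/(_ e e0)[N _ NP].
rewrite -[X in nrm X](subrKA (log_sum (fun k => x ^+ k) (maxn N K))).
apply: (nrmD_le Hp).
  apply: (log_sum_tail (rho := rho)) (ltW e0) Ke K0 _ _ => // [k|]; last exact: leq_maxr.
  by rewrite (nrmX Hp) lerXn2r ?nnegrE ?(nrm_ge0 Hp) // (le_trans (nrm_ge0 Hp x)).
apply: ltW; have := NP (maxn N K) (leq_maxl _ _).
by rewrite /= ger0_norm ?(nrm_ge0 Hp).
Qed.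

Section Mahler.
Context (d : nat) (g : laurent d Cp) (a0 : 'rV[int]_d).
Hypotheses (g_a0 : g a0 != 0) (g_dom : forall a, a != a0 -> nrm (g a) < nrm (g a0)).

(* [g = g a0 * t^a0 * (1 + h)] where [h] has Gauss norm less than 1. *)
Let h : laurent d Cp := lconst d (g a0)^-1 * (lmonom (- a0) * g) - 1.

Let gE : g = lconst d (g a0) * lmonom a0 * (1 + h).
Proof.
rewrite /h addrC subrK mulrACA -rmorphM divff // rmorph1 mul1r mulrA -lmonomD subrr.
by rewrite [lmonom 0](_ : _ = 1) ?mul1r.
Qed.

Let h_lt1 c : nrm (h c) < 1.
Proof.
rewrite /h laurentBE lconstM lmonomM opprK [X in _ - X](_ : _ = (c == 0)%:R).
  have [->|c0] := eqVneq c 0; first by rewrite add0r mulVf // subrr (nrm0 Hp).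
  rewrite subr0 (nrmM Hp) (nrmV Hp) mulrC ltr_pdivrMr ?(nrm_gt0 Hp) // mul1r g_dom //.
  by rewrite -subr_eq0 addrK.
exact: lmonomE.
Qed.

Let rho_exists : exists rho : R, [/\ 0 < rho, rho < 1 & forall c, nrm (h c) <= rho].
Proof.
(* Starting the maximum at [2^-1] keeps [rho] positive even if [h] is zero. *)
exists (\big[Num.max/2^-1]_(c <- finsupp h) nrm (h c)); split.
- apply: lt_le_trans (_ : 2^-1 <= _); first by rewrite invr_gt0.
  exact: bigmax_ge_id.
- by apply: bigmax_lt => [|c _]; rewrite ?h_lt1 // invf_lt1 ?ltr1n.
move=> c; have [ch|/fsfun_dflt->] := boolP (c \in finsupp h).
  by apply: le_bigmax_seq.
rewrite (nrm0 Hp); apply: le_trans (_ : 2^-1 <= _); first by rewrite invr_ge0.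
exact: bigmax_ge_id.
Qed.

(** The Gauss norm is submultiplicative, by the ultrametric inequality on each coefficient of a
    product. *)
Let h_pow_le (rho : R) k c : 0 <= rho -> (forall c, nrm (h c) <= rho) ->
  nrm ((h ^+ k) c) <= rho ^+ k.
Proof.
move=> rho0 hr; elim: k c => [|k IHk] c.
  by rewrite [(h ^+ 0) c]lmonomE expr0 (nrm_nat_le1 Hp).
rewrite exprS laurentME; apply: (nrm_sum_le Hp) => [|a _]; first exact: exprn_ge0.
by rewrite (nrmM Hp) exprS ler_pM ?(nrm_ge0 Hp).
Qed.

Let leval_h_le (rho : R) (z : 'rV[Cp]_d) : 0 <= rho -> (forall c, nrm (h c) <= rho) ->
  (forall i, nrm (z 0 i) = 1) -> nrm (leval h z) <= rho.
Proof.
move=> rho0 hr z1; apply: (nrm_sum_le Hp) => // a _.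
have nrmz i : nrm (z 0 i ^ a 0 i) = 1.
  by case: (a 0 i) => k; rewrite ?NegzE -?exprnN -?exprnP ?(nrmV Hp) (nrmX Hp) z1 expr1n ?invr1.
rewrite (nrmM Hp) (big_morph nrm (nrmM Hp) (nrm1 Hp)) big1 ?mulr1 //.
Qed.

Lemma mahler_limit : exists l, forall e : R, 0 < e ->
  exists m0, forall m, (m0 <= m)%N -> coprime m.+1 p ->
  forall w, m.+1.-primitive_root w ->
  nrm ((m.+1 ^ d)%:R^-1 * (\sum_(s : 'rV['I_m.+1]_d) logp (leval g (torus_pt w s))) - l) <= e.
Proof.
have [rho [rho0 rho1 h_le]] := rho_exists; have rho_ge0 := ltW rho0.
pose L := log_sum (fun k => (h ^+ k) 0).
have Lcauchy e : 0 < e -> exists2 K, (0 < K)%N &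
    (forall k, (K <= k)%N -> k%:R * rho ^+ k <= e) /\
    forall m n, (K <= m)%N -> (K <= n)%N -> nrm (L m - L n) <= e.
  move=> e0; have [K KP] := natr_mul_expr_small rho0 rho1 e0.
  have KP' k : (K.+1 <= k)%N -> k%:R * rho ^+ k <= e by move/ltnW/KP.
  exists K.+1 => //; split=> // m n Km Kn.
  apply: log_sum_tail (ltW e0) KP' _ Km Kn => // k; exact: h_pow_le.
have [l lP] : exists l, nrm (L n - l) @[n --> \oo] --> (0 : R).
  apply: (nrm_complete Hp) => e e0; have e20 : 0 < e / 2 by rewrite divr_gt0.
  have [K _ [_ KP]] := Lcauchy _ e20; exists K => m n Km Kn.
  by apply: le_lt_trans (KP _ _ Km Kn) _; rewrite ltr_pdivrMr // mulr_natr mulr2n ltrDl.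
exists (logp (g a0) + l) => e e0; have [K K0 [Ke KP]] := Lcauchy _ e0.
have Ll : nrm (L K - l) <= e.
  have /cvgr0Pnorm_lt/(_ e e0)[N _ NP] := lP.
  rewrite -(subrKA (L (maxn N K))); apply: (nrmD_le Hp).
    by apply: KP; rewrite ?leq_maxr.
  by apply: ltW; have := NP _ (leq_maxl N K); rewrite /= ger0_norm ?(nrm_ge0 Hp).
(* [bound k] dominates the exponents of [h ^+ k]; the sum of these bounds serves all [k < K] at once
   in [torus_average]. *)
pose bound k := (\sum_(a <- finsupp (h ^+ k)) \sum_i `|a ord0 i|%N)%N.
exists (\sum_(1 <= k < K) bound k)%N => m m0 mp w wP.
have n0 : (m.+1 ^ d)%:R != 0 :> Cp by rewrite (padic_natr_eq0 p_prime Hp) expn_eq0.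
have z_nrm (s : 'rV['I_m.+1]_d) i : nrm (torus_pt w s 0 i) = 1.
  rewrite mxE (nrmX Hp) (nrm_root_of_unity Hp _ (prim_expr_order wP)) ?expr1n //.
pose x (s : 'rV['I_m.+1]_d) := leval h (torus_pt w s).
have x_le s : nrm (x s) <= rho by exact: leval_h_le.
have logE s : logp (leval g (torus_pt w s)) = logp (g a0) + logp (1 + x s).
  have [ev evE] := leval_rmorph (torus_pt_neq0 wP s).
  rewrite {1}gE -evE rmorphM rmorphD rmorph1 !evE leval_const_monom.
  have z0 : zpow (torus_pt w s) a0 != 0.
    by apply/prodf_neq0 => i _; rewrite expfz_neq0 // torus_pt_neq0.
  have x0 : 1 + x s != 0.
    rewrite -(nrm_neq0 Hp) (nrmD_eq Hp) (nrm1 Hp) ?oner_eq0 //.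
    exact: le_lt_trans (x_le s) rho1.
  rewrite (logpM Hlog) ?mulf_neq0 // (logpM Hlog) //; congr (_ + _).
  (* The monomial [t^a0] takes a root of unity as value, which [logp] kills. *)
  rewrite [X in _ + X](@logp_root_of_unity _ m.+1) ?addr0 //.
  rewrite zpow_torus_pt // /chr -prodrXl big1 // => i _.
  by rewrite exprAC (prim_expr_order wP) expr1n.
have avg : (m.+1 ^ d)%:R^-1 * (\sum_s log_sum (fun k => x s ^+ k) K) = L K.
  rewrite exchange_big mulr_sumr /= big_nat [RHS]big_nat; apply: eq_bigr => k kK.
  rewrite -mulr_suml -mulr_sumr mulrA [_^-1 * _]mulrCA; congr (_ * _ / _).
  have -> : \sum_s x s ^+ k = \sum_(s : 'rV['I_m.+1]_d) leval (h ^+ k) (torus_pt w s).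
    apply: eq_bigr => s _; have [ev evE] := leval_rmorph (torus_pt_neq0 wP s).
    by rewrite /x -!evE rmorphXn.
  rewrite (torus_average wP) ?mulKf // ltnS; apply: leq_trans m0.
  by rewrite (bigD1_seq k) ?iota_uniq ?mem_index_iota //= leq_addr.
have -> : (m.+1 ^ d)%:R^-1 * (\sum_(s : 'rV['I_m.+1]_d) logp (leval g (torus_pt w s))) =
    logp (g a0) + (m.+1 ^ d)%:R^-1 * \sum_s logp (1 + x s).
  under eq_bigr => s _ do rewrite logE.
  rewrite big_split sumr_const card_mx card_ord mul1n mulrDr.
  by rewrite -[logp (g a0) *+ _]mulr_natl mulKf.
rewrite opprD addrACA subrr add0r -(subrKA (L K)); apply: (nrmD_le Hp) => //.
(* Division by [n ^ d] preserves absolute values because [n] is prime to [p]. *)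
rewrite -avg -mulrBr -sumrB (nrmM Hp) (nrmV Hp) (nrm_coprime p_prime Hp); last first.
  by rewrite coprimeXl.
rewrite invr1 mul1r; apply: (nrm_sum_le Hp) => [|s _]; first exact: ltW.
rewrite -(nrmN Hp) opprB; exact: (log_sum_logp (x_le s)).
Qed.

End Mahler.
End PadicLog.

(** * Comparison of the entropy with the Mahler measure *)

Lemma coprime_limP (R : realType) (p : nat) (Cp : fieldType) (nrm : Cp -> R)
    (u : nat -> Cp) l : prime p -> is_padic_complex p nrm ->
  (forall e : R, 0 < e -> exists m0, forall m, (m0 <= m)%N -> coprime m.+1 p ->
     nrm (u m.+1 - l) <= e) ->
  coprime_lim p nrm u l.
Proof.
move=> p_prime Hp ul; apply/cvgr0Pnorm_le => e e0; have [m0 mP] := ul e e0.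
exists m0.+1 => // -[|m] // m0m mp.
by rewrite ger0_norm ?(nrm_ge0 Hp) //; exact: mP.
Qed.

Lemma sum_torus_torsion (F : fieldType) (V : zmodType) d m (w : F) (G : 'rV[F]_d -> V) :
  m.+1.-primitive_root w ->
  \sum_(z \in torus_torsion m.+1) G z = \sum_(s : 'rV['I_m.+1]_d) G (torus_pt w s).
Proof.
move=> wP; rewrite -fsbig_finType; apply: reindex_fsbig; split.
- by move=> s _ i; rewrite mxE exprAC (prim_expr_order wP) expr1n.
- move=> s t _ _ /rowP st; apply/rowP => i; have := st i; rewrite !mxE => /eqP.
  by rewrite (eq_prim_root_expr wP) !modn_small // => /eqP; exact: val_inj.
move=> z zN; exists (\row_i sval (prim_rootP wP (zN i))) => //.
by apply/rowP => i; rewrite !mxE; case: prim_rootP.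
Qed.

Theorem theorem1p4 (R : realType) (p : nat) (Cp : fieldType) (nrm : Cp -> R)
    (logp : Cp -> Cp) (d : nat) (K : fieldExtType rat)
    (f : laurent d (int_ring K)) :
  prime p ->
  is_padic_complex p nrm ->
  is_padic_log p nrm logp ->
  (0 < d)%N ->
  (forall z : 'rV[Cp]_d, (forall i, nrm (z 0 i) = 1) ->
     leval (lmap intr (lnorm R f)) z != 0) ->
  exists h : Cp,
    padic_entropy p nrm logp (dual_shift (R := R) (f := f)) h /\
    padic_mahler p nrm logp (lmap intr (lnorm R f)) h.
Proof.
move=> p_prime Hp Hlog _ g_torus.
have [r [w [B [w_gen w_free fwE gE]]]] := lnorm_det R f.
have [a0 ga0 g_dom] := dominant_monomial p_prime Hp g_torus.
set g := lmap intr (lnorm R f) in g_torus *.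
have g_a0 : g a0 != 0 by rewrite lmapE (padic_intr_eq0 p_prime Hp).
have {}g_dom a : a != a0 -> nrm (g a) < nrm (g a0) by rewrite !lmapE; exact: g_dom.
have [l lP] := mahler_limit p_prime Hp Hlog g_a0 g_dom.
have prim_root m : exists z : Cp, m.+1.-primitive_root z.
  exact: padic_prim_root p_prime Hp _ (ltn0Sn m).
have g_torsion N z : (0 < N)%N -> torus_torsion N z -> leval g z != 0.
  by move=> N0 zN; apply: g_torus => i; exact: (nrm_root_of_unity Hp N0 (zN i)).
have g_pt m z s : m.+1.-primitive_root z -> leval g (torus_pt z s) != 0.
  move=> zP; apply: (g_torsion m.+1) => // i.
  by rewrite mxE exprAC (prim_expr_order zP) expr1n.
(* This excludes [n = 0], so every admissible [n] is some [m.+1]. *)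
have coprime0 : ~~ coprime 0 p by rewrite /coprime gcd0n gtn_eqF // prime_gt1.
pose D m := \det (circulant m B).
have DE m z : m.+1.-primitive_root z ->
    (D m)%:~R = \prod_(s : 'rV['I_m.+1]_d) leval g (torus_pt z s).
  by move=> zP; rewrite /D (det_circulant B zP) /g gE.
have D0 m : D m != 0.
  have [z zP] := prim_root m; rewrite -(padic_intr_eq0 p_prime Hp) (DE m z zP).
  by apply/prodf_neq0 => s _; exact: g_pt zP.
have logD m z : m.+1.-primitive_root z ->
    logp (absz (D m))%:R = \sum_(s : 'rV['I_m.+1]_d) logp (leval g (torus_pt z s)).
  move=> zP; rewrite -(logp_prod Hlog) => [|s _]; last exact: g_pt zP.
  (* The determinant may be negative, but its sign does not affect the logarithm. *)
  rewrite -DE //; case: (D m) (D0 m) => k // k0; rewrite NegzE mulrNz.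
  by rewrite (logpN p_prime Hp Hlog) // -pmulrn (padic_natr_eq0 p_prime Hp).
exists l; split; last split.
- exists (fun n => absz (D n.-1)); split=> [[|m] mp|]; first by rewrite mp in coprime0.
    exact: card_fixed_points w_gen w_free fwE (D0 m).
  apply: coprime_limP => // e e0; have [m0 mP] := lP e e0; exists m0 => m mm mp.
  have [z zP] := prim_root m; rewrite /= (logD m z zP) mulrC.
  exact: mP zP.
- move=> [|N] Np z zN; first by rewrite Np in coprime0.
  exact: g_torsion zN.
apply: coprime_limP => // e e0; have [m0 mP] := lP e e0; exists m0 => m mm mp.
have [z zP] := prim_root m; rewrite (sum_torus_torsion _ zP).
exact: mP zP.
Qed.
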